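(* Let $\tau>0$. There exist separable Hilbert spaces $V,H$ such that $V$ is continuously and densely embedded in $H$, and there exists a non-autonomous coercive form $\mathfrak a\colon[0,\tau]\times V\times V\to\mathbb C$ such that the following holds. Let $\mathcal A(t)\in\mathscr L(V,V')$ be given by $\langle\mathcal A(t)v,w\rangle_{V',V}:=\mathfrak a(t,v,w)$. Let $\Phi\in\mathscr L(H)$. Then there exists a $g\in L^2(0,\tau;H)$ such that the solution $u\in\mathrm{MR}(V,V')$ of $$\dot u+\mathcal A(\cdot)u=g,\qquad u(0)=\Phi u(\tau),$$ is not in $\mathrm{MR}(V,H)$.
   Context: $\mathscr L(H)$ denotes the bounded linear operators on $H$, and $\mathscr L(V,V')$ the bounded linear operators from $V$ to $V'$. The Hilbert spaces are complex. $H$ is identified with a dense subspace of $V'$ via $x\mapsto(v\mapsto (x\mid v)_H)$. A coercive non-autonomous form is a map $\mathfrak a\colon[0,\tau]\times V\times V\to\mathbb C$ such that $\mathfrak a(t,\cdot,\cdot)$ is sesquilinear for all $t\in[0,\tau]$, $\mathfrak a(\cdot,v,w)$ is measurable for all $v,w\in V$, there is $M\ge0$ with $|\mathfrak a(t,v,w)|\le M\|v\|_V\|w\|_V$ for all $v,w\in V$, $t\in[0,\tau]$, and there is $\alpha>0$ with $\operatorname{Re}\mathfrak a(t,v,v)\ge\alpha\|v\|_V^2$ for all $v\in V$, $t\in[0,\tau]$. $\mathrm{MR}(V,V'):=H^1(0,\tau;V')\cap L^2(0,\tau;V)\subset C([0,\tau];H)$ and $\mathrm{MR}(V,H):=H^1(0,\tau;H)\cap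 L^2(0,\tau;V)$. The equation $\dot u+\mathcal A(\cdot)u=g$ is understood in $V'$ for a.e. $t\in(0,\tau)$. *)

(* Defs.v *)
From HB Require Import structures.
From mathcomp Require Import all_boot all_order all_algebra.
From mathcomp Require Import sesquilinear.
From mathcomp Require Import all_classical all_reals all_analysis.
From mathcomp.real_closed Require Import complex.

Set Implicit Arguments.
Unset Strict Implicit.
Unset Printing Implicit Defensive.

Import Order.TTheory GRing.Theory Num.Theory.
Import numFieldNormedType.Exports.

Local Open Scope classical_set_scope.
Local Open Scope complex_scope.
Local Open Scope ring_scope.

(* Over the scalar field R[i], library norms take their values in R[i]. *)
Definition normR (R : realType) (X : normedModType R[i]) (x : X) : R :=
  complex.Re `|x|.

(* Inner products are linear in the first and antilinear in the second
   argument. *)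
HB.mixin Record CompleteNormedModule_isHilbert (R : realType) H
    of CompleteNormedModule R[i] H := {
  inner : {dot H for @Num.conj R[i]} ;
  sqr_norm_inner : forall x : H, `|x| ^+ 2 = inner x x
}.

#[short(type="hilbertType")]
HB.structure Definition Hilbert (R : realType) :=
  {H of CompleteNormedModule R[i] H & CompleteNormedModule_isHilbert R H}.

Definition separable_space (T : topologicalType) : Prop :=
  exists D : set T, countable D /\ dense D.

Definition bounded_operator (R : realType) (X Y : normedModType R[i])
    (f : X -> Y) : Prop :=
  linear f /\ exists M : R, forall x, normR (f x) <= M * normR x.

Section NormR.
Variables (R : realType) (X : normedModType R[i]).
Implicit Types x y : X.

Lemma normRE x : `|x| = (normR x)%:C.
Proof.
have := normr_ge0 x; rewrite /normR lecE => /andP[/eqP h _].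
by move: h; case: `|x| => a b /= ->.
Qed.

Lemma normR_ge0 x : 0 <= normR x.
Proof. by rewrite -ler0c -normRE. Qed.

Lemma ler_normRD x y : normR (x + y) <= normR x + normR y.
Proof. by rewrite -lecR rmorphD /= -!normRE ler_normD. Qed.

Lemma normRZ (l : R[i]) x : normR (l *: x) = complex.Re `|l| * normR x.
Proof.
by apply: (@complexI R); rewrite rmorphM /= -!normRE normrZ; congr (_ * _).
Qed.

Lemma normR_eq0 x : (normR x == 0) = (x == 0).
Proof.
by rewrite -(inj_eq (@complexI R)) -normRE normr_eq0.
Qed.

Lemma normR0 : normR (0 : X) = 0.
Proof. by apply/eqP; rewrite normR_eq0. Qed.
End NormR.

Section CauchySchwarz.
Variables (R : realType) (H : hilbertType R).
Implicit Types x y : H.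

Lemma normR_inner x y : normR (inner x y : R[i]^o) <= normR x * normR y.
Proof.
have [->|y0] := eqVneq y 0.
  by rewrite linear0r !normR0 mulr0.
rewrite -lecR rmorphM /= -!normRE.
rewrite -(@ler_pXn2r _ 2) ?nnegrE ?mulr_ge0 ?normr_ge0// exprMn.
have yy : 0 < (inner y y : R[i]) by exact: neq0_dnorm_gt0.
pose c : R[i] := inner x y / inner y y.
have xcy : inner (x - c *: y) y = 0.
  by rewrite linearBl/= linearZl_LR/= /c divfK ?gt_eqF// subrr.
have : 0 <= `|x - c *: y| ^+ 2 by rewrite exprn_ge0.
rewrite sqr_norm_inner linearBr/= linearZr_LR/= xcy mulr0 subr0.
rewrite linearBl/= linearZl_LR/= subr_ge0 /c.
rewrite mulrAC ler_pdivrMr// => h; rewrite !sqr_norm_inner normCK.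
by move: h; rewrite [inner y x]hermC expr0 mul1r.
Qed.
End CauchySchwarz.

Section Antidual.
Variables (R : realType) (V : normedModType R[i]).

Definition antilinear (f : V -> R[i]) : Prop :=
  forall (l : R[i]) x y, f (l *: x + y) = Num.conj l * f x + f y.

Definition bounded_antilinear : {pred V -> R[i]^o} :=
  [pred f | `[< antilinear f /\
                exists M : R, forall x, normR (f x : R[i]^o) <= M * normR x >]].

(* The antidual V': bounded antilinear functionals on V. *)
Record antidual := Antidual {
  antidual_fun :> V -> R[i]^o ;
  antidualP : antidual_fun \in bounded_antilinear
}.

HB.instance Definition _ := [isSub for antidual_fun].
HB.instance Definition _ := [Choice of antidual by <:].

Lemma bounded_antilinear_submod : submod_closed bounded_antilinear.
Proof.
split=> [|l f g].
  apply/asboolP; split=> [a x y|].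
    by rewrite /= mulr0 addr0.
  by exists 0 => x; rewrite mul0r (@normR0 R R[i]^o).
move=> /asboolP[fl [M fM]] /asboolP[gl [N gN]]; apply/asboolP; split.
  move=> a x y.
  rewrite -[LHS]/(l * f (a *: x + y) + g (a *: x + y)).
  rewrite -[RHS]/(Num.conj a * (l * f x + g x) + (l * f y + g y)).
  rewrite fl gl !mulrDr !addrA; congr (_ + _).
  by rewrite addrAC [l * (_ * _)]mulrCA.
exists (complex.Re `|l| * M + N) => x.
rewrite -[X in normR X]/(l *: (f x : R[i]^o) + (g x : R[i]^o)).
rewrite (le_trans (ler_normRD _ _))// mulrDl lerD// normRZ -mulrA.
by rewrite ler_wpM2l// (@normR_ge0 R R[i]^o l).
Qed.

HB.instance Definition _ := GRing.isSubmodClosed.Build R[i] (V -> R[i]^o)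
  bounded_antilinear bounded_antilinear_submod.
HB.instance Definition _ := [SubChoice_isSubLmodule of antidual by <:].

Implicit Types f g : antidual.

Definition dual_norm f : R :=
  sup [set normR (f x : R[i]^o) | x in [set x : V | normR x <= 1]].

Lemma antidualZ f (l : R[i]) x : f (l *: x) = Num.conj l * f x.
Proof.
have /asboolP[fl _] := antidualP f.
have f0 : f 0 = 0.
  by have := fl 1 0 0; rewrite scale1r addr0 rmorph1 mul1r => /esym/eqP;
     rewrite -subr_eq0 addrK => /eqP.
by rewrite -[l *: x]addr0 fl f0 addr0.
Qed.

Lemma dual_norm_has_sup f :
  has_sup [set normR (f x : R[i]^o) | x in [set x : V | normR x <= 1]].
Proof.
split.
  exists (normR (f 0 : R[i]^o)), 0 => //=.
  by rewrite normR0.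
have /asboolP[_ [M fM]] := antidualP f.
exists `|M| => _ [x /= x1 <-]; apply: (le_trans (fM x)).
rewrite (le_trans (ler_norm _))// normrM ler_piMr//.
by rewrite ger0_norm ?normR_ge0.
Qed.

Lemma ler_dual_norm f x : normR (f x : R[i]^o) <= dual_norm f * normR x.
Proof.
have [->|x0] := eqVneq x 0.
  have -> : f 0 = 0 by rewrite -(scale0r 0) antidualZ rmorph0 mul0r.
  by rewrite !normR0 mulr0.
have nx : 0 < normR x by rewrite lt_def normR_ge0 normR_eq0 x0.
rewrite -ler_pdivrMr//.
have -> : normR (f x : R[i]^o) / normR x
        = normR (f ((normR x)^-1%:C *: x) : R[i]^o).
  rewrite antidualZ -[_ * f x]/(_ *: (f x : R[i]^o)) normRZ mulrC; congr (_ * _).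
  by rewrite norm_conjC ger0_norm// ler0c invr_ge0 ltW.
apply: (sup_upper_bound (dual_norm_has_sup f)).
exists ((normR x)^-1%:C *: x) => //=.
rewrite normRZ ger0_norm ?ler0c ?invr_ge0 ?normR_ge0//=.
by rewrite mulVf ?gt_eqF.
Qed.

Lemma dual_norm_le f (M : R) :
  (forall x, normR (f x : R[i]^o) <= M * normR x) -> 0 <= M -> dual_norm f <= M.
Proof.
move=> fM M0; apply: ge_sup; first exact: (dual_norm_has_sup f).1.
by move=> _ [x /= x1 <-]; rewrite (le_trans (fM x))// ler_piMr.
Qed.

Lemma dual_norm_ge0 f : 0 <= dual_norm f.
Proof.
apply: (le_trans (normR_ge0 (f 0 : R[i]^o))).
apply: (sup_upper_bound (dual_norm_has_sup f)).
by exists 0 => //=; rewrite normR0.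
Qed.

Lemma dual_normD f g :
  (dual_norm (f + g))%:C <= (dual_norm f)%:C + (dual_norm g)%:C.
Proof.
rewrite -rmorphD lecR; apply: dual_norm_le; last first.
  by rewrite addr_ge0 ?dual_norm_ge0.
move=> x; rewrite -[X in normR X]/((f x : R[i]^o) + (g x : R[i]^o)).
by rewrite (le_trans (ler_normRD _ _))// mulrDl lerD ?ler_dual_norm.
Qed.

Lemma dual_normZ (l : R[i]) f :
  (dual_norm (l *: f))%:C = `|l| * (dual_norm f)%:C.
Proof.
have le k h : dual_norm (k *: h) <= complex.Re `|k| * dual_norm h.
  apply: dual_norm_le; last first.
    by rewrite mulr_ge0 ?dual_norm_ge0 ?(@normR_ge0 R R[i]^o k).
  move=> x; rewrite -[X in normR X]/(k *: (h x : R[i]^o)) normRZ -mulrA.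
  by rewrite ler_wpM2l ?ler_dual_norm ?(@normR_ge0 R R[i]^o k).
rewrite (@normRE R R[i]^o l) -rmorphM /=; congr (_%:C); apply/eqP.
rewrite eq_le le/=; have [->|l0] := eqVneq l 0.
  by rewrite (@normR0 R R[i]^o) mul0r dual_norm_ge0.
have nl : 0 < normR (l : R[i]^o) by rewrite lt_def normR_ge0 normR_eq0 l0.
rewrite -ler_pdivlMl//; have := le l^-1 (l *: f).
rewrite scalerA mulVf// scale1r => /le_trans; apply.
by rewrite normfV (@normRE R R[i]^o l) -fmorphV.
Qed.

Lemma dual_norm0_eq0 f : (dual_norm f)%:C = 0 -> f = 0.
Proof.
move=> [f0]; apply/val_inj/funext => x; apply/eqP.
rewrite -(@normR_eq0 R R[i]^o) eq_le normR_ge0 andbT.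
by rewrite (le_trans (ler_dual_norm f x))// f0 mul0r.
Qed.

HB.instance Definition _ := Lmodule_isNormed.Build R[i] antidual
  dual_normD dual_normZ dual_norm0_eq0.

End Antidual.

Section Bochner.
Variables (R : realType) (X : normedModType R[i]).
Local Notation mu := (@lebesgue_measure R).
Implicit Types (D : set R) (f g s : R -> X).

Definition simple_fun s : Prop :=
  finite_set (range s) /\ forall x, measurable (s @^-1` [set x]).

(* Intended for D of finite measure, since [fine] maps +oo to 0. *)
Definition simple_integral D s : X :=
  \sum_(x \in range s) (fine (mu (D `&` s @^-1` [set x])))%:C *: x.

Definition strongly_measurable D f : Prop :=
  exists s : nat -> R -> X, (forall n, simple_fun (s n)) /\
    {ae mu, forall t, D t -> s n t @[n --> \oo] --> f t}.

Definition has_bochner_integral D f (I : X) : Prop :=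
  strongly_measurable D f /\
  exists s : nat -> R -> X, [/\ forall n, simple_fun (s n),
    (\int[mu]_(t in D) (normR (f t - s n t))%:E)%E @[n --> \oo] --> 0%E &
    simple_integral D (s n) @[n --> \oo] --> I].

Variable tau : R.

Definition L2 f : Prop := strongly_measurable `]0, tau[ f /\
  (\int[mu]_(t in `]0%R, tau[) (normR (f t) ^+ 2)%:E < +oo)%E.

Definition test_function (phi : R -> R) : Prop :=
  [/\ forall n t, derivable (derive1n n phi) t 1,
      compact (closure [set t | phi t != 0]) &
      closure [set t | phi t != 0] `<=` `]0, tau[].

Definition weak_derivative f g : Prop :=
  forall phi, test_function phi -> exists I : X,
    has_bochner_integral `]0, tau[ (fun t => (derive1 phi t)%:C *: f t) I /\
    has_bochner_integral `]0, tau[ (fun t => (phi t)%:C *: g t) (- I).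

Definition H1 f : Prop := L2 f /\ exists g, L2 g /\ weak_derivative f g.

End Bochner.

Section NonAutonomousForms.
Variables (R : realType) (V H : hilbertType R).
Local Notation mu := (@lebesgue_measure R).

Record dense_embedding := DenseEmbedding {
  embed :> V -> H ;
  embed_linear : linear embed ;
  embed_inj : injective embed ;
  embed_continuous : continuous embed ;
  embed_dense : dense (range embed)
}.

Definition sesquilinear (b : V -> V -> R[i]) : Prop :=
  (forall (l : R[i]) v1 v2 w, b (l *: v1 + v2) w = l * b v1 w + b v2 w) /\
  (forall v, antilinear (b v)).

(* A form on [0, tau] is a function of t in R of which only the values for t in
   [0, tau] matter. *)
Record coercive_form (tau : R) := CoerciveForm {
  form :> R -> V -> V -> R[i] ;
  form_sesquilinear : forall t, t \in `[0, tau] -> sesquilinear (form t) ;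
  form_measurable : forall v w,
    measurable_fun `[0, tau] (fun t => complex.Re (form t v w)) /\
    measurable_fun `[0, tau] (fun t => complex.Im (form t v w)) ;
  form_bounded : exists M : R, 0 <= M /\ forall t v w, t \in `[0, tau] ->
    normR (form t v w : R[i]^o) <= M * normR v * normR w ;
  form_coercive : exists alpha : R, 0 < alpha /\ forall t v, t \in `[0, tau] ->
    alpha * normR v ^+ 2 <= complex.Re (form t v v)
}.

Section Operators.
Variables (tau : R) (j : dense_embedding) (a : coercive_form tau).

Fact form_op_subproof t v : t \in `[0, tau] ->
  (a t v : V -> R[i]^o) \in @bounded_antilinear R V.
Proof.
move=> tI; apply/asboolP; split; first exact: (form_sesquilinear a tI).2.
have [M [_ aM]] := form_bounded a.
by exists (M * normR v) => w; exact: aM.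
Qed.

(* The operator A(t) : V -> V', <A(t) v, w> = a(t, v, w); it is 0 for t outside
   [0, tau]. *)
Definition form_op (t : R) (v : V) : antidual V := insubd 0 (a t v : V -> R[i]^o).

Lemma form_opE t v w : t \in `[0, tau] -> form_op t v w = a t v w.
Proof. by move=> tI; rewrite /form_op (insubdK _ (form_op_subproof v tI)). Qed.

Lemma form_op_bounded t : t \in `[0, tau] -> bounded_operator (form_op t).
Proof.
move=> tI; split=> [l v1 v2|].
  apply/val_inj/funext => w /=.
  rewrite -[RHS]/(l * form_op t v1 w + form_op t v2 w) !form_opE//.
  exact: (form_sesquilinear a tI).1.
have [M [M0 aM]] := form_bounded a; exists M => v.
apply: dual_norm_le => [w|]; last by rewrite mulr_ge0 ?normR_ge0.
by rewrite form_opE//; exact: aM.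
Qed.

Lemma embed_bounded : bounded_operator j.
Proof.
split; first exact: embed_linear.
pose jl : {linear V -> H} := HB.pack (embed j)
  (GRing.isLinear.Build R[i] V H *:%R j (@embed_linear j)).
have /linear_bounded_continuous/linear_boundedP : continuous jl.
  exact: (@embed_continuous j).
move=> [M [Mreal jM]].
have M1 : M < `|M| + 1 by rewrite (le_lt_trans (real_ler_norm _))// ltrDl.
exists (complex.Re (`|M| + 1)) => v; rewrite -lecR rmorphM /= -!normRE.
suff -> : (complex.Re (`|M| + 1))%:C = `|M| + 1 by exact: jM.
have : 0 <= `|M| + 1 :> R[i] by rewrite addr_ge0.
by rewrite lecE => /andP[/eqP + _]; case: (`|M| + 1) => p q /= ->.
Qed.

Fact embed_dual_subproof (x : H) :
  ((fun v => inner x (j v)) : V -> R[i]^o) \in @bounded_antilinear R V.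
Proof.
apply/asboolP; split=> [l v w|].
  by rewrite (embed_linear j) linearPr.
have [_ [M jM]] := embed_bounded; exists (normR x * M) => v.
rewrite (le_trans (normR_inner _ _))// -mulrA.
by rewrite ler_wpM2l ?normR_ge0.
Qed.

(* The identification of H with a subspace of V', x |-> (v |-> (x | v)_H). *)
Definition embed_dual (x : H) : antidual V := Antidual (embed_dual_subproof x).

Definition MR_VVdual (u : R -> V) : Prop :=
  L2 tau u /\ H1 tau (fun t => embed_dual (j (u t))).

Definition MR_VH (u : R -> V) : Prop :=
  L2 tau u /\ H1 tau (fun t => j (u t)).

(* The boundary values refer to the representative of u in C([0, tau]; H). *)
Definition boundary_condition (Phi : H -> H) (u : R -> V) : Prop :=
  exists uc : R -> H, [/\ {within `[0, tau], continuous uc},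
    {ae mu, forall t, t \in `]0, tau[ -> uc t = j (u t)} &
    uc 0 = Phi (uc tau)].

Definition evolution_equation (g : R -> H) (u : R -> V) : Prop :=
  exists du : R -> antidual V, [/\ L2 tau du,
    weak_derivative tau (fun t => embed_dual (j (u t))) du &
    {ae mu, forall t, t \in `]0, tau[ ->
       du t + form_op t (u t) = embed_dual (g t)}].

Definition solution (Phi : H -> H) (g : R -> H) (u : R -> V) : Prop :=
  [/\ MR_VVdual u, evolution_equation g u & boundary_condition Phi u].

End Operators.
End NonAutonomousForms.

(* Main.v *)
From HB Require Import structures.
Require Import Defs.
From mathcomp Require Import all_boot all_order all_algebra.
From mathcomp Require Import sesquilinear.
From mathcomp Require Import all_classical all_reals all_analysis.
From mathcomp Require Import measurable_realfun complex ring lra.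

(** Take [V = H = l2], embedded by the diagonal operator with entries
    [w_n = 2^-n], so that [V'] is again [l2] by Riesz, and let the form be
    [a(t, v, w) = (v | w) + v_0 (S(t) | w)], a rank-one perturbation of the
    inner product with [S_0 = 0] and
    [S_n(t) = - w_n (1 - i) exp(- i K_n t) / 4] for [n > 0], [K_n = w_n^-2 = 4^n].
    The equation decouples: [v_0] solves a scalar equation and drives
    [w_n^2 v_n' + v_n + v_0 S_n = w_n g_n].  The oscillation of [S_n] at its own
    relaxation rate [K_n] makes [(w_n v_n)'] of order [|v_0|], uniformly in [n];
    it is thus not square summable wherever [v_0] does not vanish.

    With [x(t) = sin(pi t / tau)], the function [u_0 = x],
    [u_n = w_n x exp(- i K_n t) / 4] solves the problem with
    [g_0 = x' + x], [g_n = w_n^2 x' exp(- i K_n t) / 4], and it vanishes at [0]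
    and [tau], hence satisfies every linear boundary condition.  For an arbitrary
    solution [y], only the scalar equation [y_0' + y_0 = x' + x] matters: if the
    weak derivative [h] of [(w_n y_n)] were in [L^2(0, tau; l2)], testing with
    [psi cos(K_n t)] and [psi sin(K_n t)] and letting [n] tend to infinity would
    give [\int psi Re y_0 = 0] for every test function [psi], so that
    [x' + x = 0], which is absurd. *)

(** The form is found backwards from the solution. In [w_n^2 u_n' + u_n + u_0 S_n = w_n g_n] with
    [u_0 = x] and [u_n = w_n x exp(- i K_n t) / 4], differentiating the exponential contributes
    [- i u_n], because [w_n^2 K_n = 1]. Letting [x S_n] absorb [(1 - i) u_n] leaves a right-hand
    side that contains only [x']. The factor 1/4 makes [S] small enough for coercivity.

    The obstacle for an arbitrary solution is that isolating the regular derivative gives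
    [h_n = g_n - w_n^-1 y_n - y_0 S_n / w_n], where nothing bounds [w_n^-1 y_n]. Testing at
    frequency [K_n] removes this term: the weak form of [h] moves the derivative onto the
    exponential and produces [w_n K_n y_n = w_n^-1 y_n], which cancels it. Apart from the [y_0]
    term, what is left is made of the coordinates [g_n], [h_n], [y_n] with bounded coefficients. At
    fixed [t] they tend to 0 as coordinates of vectors of [l2], so dominated convergence takes the
    place of a Riemann-Lebesgue argument, and no representation of [y_n] enters. *)

Set Implicit Arguments.
Unset Strict Implicit.
Unset Printing Implicit Defensive.

Import Order.TTheory GRing.Theory Num.Theory.
Import numFieldNormedType.Exports.

Local Open Scope classical_set_scope.
Local Open Scope complex_scope.
Local Open Scope ring_scope.

(** * The Hilbert space of square-summable complex sequences *)

Section ComplexSeries.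
Variable R : realType.
Implicit Types (z w : R[i]) (a b f g : nat -> R[i]).

Definition sqn z : R := complex.Re z ^+ 2 + complex.Im z ^+ 2.

Lemma sqn_ge0 z : 0 <= sqn z.
Proof. by rewrite addr_ge0 ?sqr_ge0. Qed.

Lemma sqnM z w : sqn (z * w) = sqn z * sqn w.
Proof. by case: z => ? ?; case: w => ? ?; rewrite /sqn /=; ring. Qed.

Lemma sqnD_le z w : sqn (z + w) <= 2 * (sqn z + sqn w).
Proof.
case: z => p q; case: w => r s; rewrite /sqn /= -subr_ge0.
rewrite (_ : _ - _ = (p - r) ^+ 2 + (q - s) ^+ 2); last by ring.
by rewrite addr_ge0 ?sqr_ge0.
Qed.

Lemma mulr_conjC z : z * Num.conj z = (sqn z)%:C.
Proof.
by case: z => p q; rewrite /sqn /=; apply/eqP; rewrite eq_complex /=; apply/andP;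
  split; apply/eqP; ring.
Qed.

Lemma sqn_eq0 z : sqn z = 0 -> z = 0.
Proof.
case: z => p q /eqP; rewrite /sqn /= paddr_eq0 ?sqr_ge0// !sqrf_eq0.
by move=> /andP[/eqP -> /eqP ->].
Qed.

Definition csummable a := cvgn (series (fun n => complex.Re (a n))) /\
  cvgn (series (fun n => complex.Im (a n))).

(** Real and imaginary parts are summed separately, so that only real series and their comparison
    tests occur. *)
Definition csum a : R[i] := limn (series (fun n => complex.Re (a n)))
  +i* limn (series (fun n => complex.Im (a n))).

Lemma csumP a p q :
  series (fun n => complex.Re (a n)) @ \oo --> p ->
  series (fun n => complex.Im (a n)) @ \oo --> q ->
  csum a = p +i* q.
Proof. by move=> ap aq; rewrite /csum (cvg_lim _ ap)// (cvg_lim _ aq). Qed.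

Lemma cvg_csum_comb (l : R[i]) a b : csummable a -> csummable b ->
  series (fun n => complex.Re (l * a n + b n)) @ \oo -->
    complex.Re (l * csum a + csum b) /\
  series (fun n => complex.Im (l * a n + b n)) @ \oo -->
    complex.Im (l * csum a + csum b).
Proof.
case: l => p q [ar ai] [br bi]; split.
- rewrite [X in X @ _ --> _](_ : _ = fun N =>
    (p * series (fun n => complex.Re (a n)) N - q * series (fun n => complex.Im (a n)) N)
    + series (fun n => complex.Re (b n)) N); last first.
    apply/funext => N; rewrite /series /= !mulr_sumr -sumrB -big_split /=.
    by apply: eq_bigr => n _; case: (a n) => ? ?; case: (b n).
  by apply: cvgD => //; apply: cvgB; apply: cvgMr.
- rewrite [X in X @ _ --> _](_ : _ = fun N =>
    (p * series (fun n => complex.Im (a n)) N + q * series (fun n => complex.Re (a n)) N)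
    + series (fun n => complex.Im (b n)) N); last first.
    apply/funext => N; rewrite /series /= !mulr_sumr -!big_split /=.
    by apply: eq_bigr => n _; case: (a n) => ? ?; case: (b n).
  by apply: cvgD => //; apply: cvgD; apply: cvgMr.
Qed.

Lemma csum_comb (l : R[i]) a b : csummable a -> csummable b ->
  csum (fun n => l * a n + b n) = l * csum a + csum b.
Proof.
move=> sa sb; have [hr hi] := cvg_csum_comb l sa sb.
by rewrite (csumP hr hi); case: (_ + _).
Qed.

Lemma csum_conj a : csummable a ->
  csum (fun n => Num.conj (a n)) = Num.conj (csum a).
Proof.
move=> [ar ai]; rewrite (@csumP _ (limn (series (fun n => complex.Re (a n))))
   (- limn (series (fun n => complex.Im (a n)))))//.
- rewrite [X in series X](_ : _ = (fun n => complex.Re (a n)))//.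
  by apply/funext => n; case: (a n).
- rewrite [X in X @ _ --> _](_ : _ = - series (fun n => complex.Im (a n))).
    exact: cvgN.
  apply/funext => N; rewrite fctE /series /= -sumrN.
  by apply: eq_bigr => n _; case: (a n).
Qed.

(** Bounded partial sums are equivalent to convergence here, and they pass more easily through sums,
    weights and limits. *)
Definition sqsum f := exists M : R, forall N, \sum_(n < N) sqn (f n) <= M.

Lemma sqsum_cvg f : sqsum f -> cvgn (series (fun n => sqn (f n))).
Proof.
move=> [M fM]; apply: nondecreasing_is_cvgn.
  by apply: nondecreasing_series => n _ _; exact: sqn_ge0.
by exists M => _ [N _ <-]; rewrite /series /= big_mkord.
Qed.

Lemma sqsum_comb (l : R[i]) f g : sqsum f -> sqsum g ->
  sqsum (fun n => l * f n + g n).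
Proof.
move=> [M fM] [M' gM]; exists (2 * (sqn l * M + M')) => N.
apply: (@le_trans _ _ (\sum_(n < N) 2 * (sqn l * sqn (f n) + sqn (g n)))).
  by apply: ler_sum => n _; rewrite -sqnM sqnD_le.
rewrite -mulr_sumr; apply: ler_wpM2l => //; rewrite big_split /= -mulr_sumr.
by apply: lerD (gM N); rewrite ler_wpM2l ?sqn_ge0 ?fM.
Qed.

(** Comparison with [|f|^2 + |g|^2]: each of the four gaps, for either sign of the real and of the
    imaginary part, is half a sum of squares. *)
Lemma csummable_mulconj f g : sqsum f -> sqsum g ->
  csummable (fun n => f n * Num.conj (g n)).
Proof.
move=> sf sg.
have c : cvgn (series (fun n => sqn (f n) + sqn (g n))).
  rewrite [X in cvgn X](_ : _ = series (fun n => sqn (f n)) +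
     series (fun n => sqn (g n))); last first.
    by apply/funext => N; rewrite /series /= big_split.
  by apply: is_cvgD; exact: sqsum_cvg.
have fg0 n : 0 <= sqn (f n) + sqn (g n) by rewrite addr_ge0 ?sqn_ge0.
split; apply: normed_cvg; apply: (series_le_cvg _ fg0 _ c) => n //=.
all: case: (f n) => p q; case: (g n) => r s.
all: rewrite /sqn /= ler_norml; apply/andP; split; rewrite -subr_ge0.
- rewrite (_ : _ - _ = ((p + r) ^+ 2 + (q + s) ^+ 2 + (p^+2+q^+2+r^+2+s^+2))/2);
    last by field.
  by rewrite divr_ge0 ?addr_ge0 ?sqr_ge0.
- rewrite (_ : _ - _ = ((p - r) ^+ 2 + (q - s) ^+ 2 + (p^+2+q^+2+r^+2+s^+2))/2);
    last by field.
  by rewrite divr_ge0 ?addr_ge0 ?sqr_ge0.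
- rewrite (_ : _ - _ = ((p - s) ^+ 2 + (q + r) ^+ 2 + (p^+2+q^+2+r^+2+s^+2))/2);
    last by field.
  by rewrite divr_ge0 ?addr_ge0 ?sqr_ge0.
- rewrite (_ : _ - _ = ((p + s) ^+ 2 + (q - r) ^+ 2 + (p^+2+q^+2+r^+2+s^+2))/2);
    last by field.
  by rewrite divr_ge0 ?addr_ge0 ?sqr_ge0.
Qed.

End ComplexSeries.

(** * Inner product and norm of [l2] *)

Section L2space.
Variable R : realType.

Definition sqsum_pred : {pred nat -> R[i]^o} := [pred f | `[< sqsum f >]].

Record l2 := MkL2 { l2fun :> nat -> R[i]^o ; l2P : l2fun \in sqsum_pred }.

HB.instance Definition _ := [isSub for l2fun].
HB.instance Definition _ := [Choice of l2 by <:].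

Lemma sqsum_submod : submod_closed sqsum_pred.
Proof.
split=> [|l f g].
  by apply/asboolP; exists 0 => N; rewrite big1// => n _; rewrite /sqn /= expr0n addr0.
by move=> /asboolP sf /asboolP sg; apply/asboolP; exact: sqsum_comb.
Qed.

HB.instance Definition _ := GRing.isSubmodClosed.Build R[i] (nat -> R[i]^o)
  sqsum_pred sqsum_submod.
HB.instance Definition _ := [SubChoice_isSubLmodule of l2 by <:].

Implicit Types f g h : l2.

Lemma l2_sqsum f : sqsum f.
Proof. by have /asboolP := l2P f. Qed.

Lemma l2D f g n : (f + g) n = f n + g n. Proof. by []. Qed.
Lemma l2N f n : (- f) n = - f n. Proof. by []. Qed.
Lemma l2Z (l : R[i]) f n : (l *: f) n = l * f n. Proof. by []. Qed.
Lemma l2B f g n : (f - g) n = f n - g n. Proof. by []. Qed.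

Lemma l2_ext f g : (forall n, f n = g n) -> f = g.
Proof. by move=> fg; apply/val_inj/funext. Qed.

Definition l2inner f g : R[i] := csum (fun n => f n * Num.conj (g n)).

Lemma l2innerPl g : linear_for *%R (l2inner^~ g).
Proof.
move=> l f h; rewrite /l2inner.
rewrite -csum_comb; try exact: csummable_mulconj (l2_sqsum _) (l2_sqsum _).
by congr csum; apply/funext => n; rewrite l2D l2Z mulrDl mulrA.
Qed.

Lemma l2inner_conj f g : l2inner f g = Num.conj (l2inner g f).
Proof.
rewrite /l2inner -csum_conj; last exact: csummable_mulconj (l2_sqsum _) (l2_sqsum _).
by congr csum; apply/funext => n; rewrite rmorphM /= conjCK mulrC.
Qed.

Lemma l2innerPr f : linear_for (Num.conj \; *%R) (l2inner f).
Proof.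
move=> l g h; rewrite l2inner_conj l2innerPl rmorphD rmorphM /=.
by rewrite -!l2inner_conj.
Qed.

HB.instance Definition _ := @bilinear_isBilinear.Build R[i] l2 l2 R[i]
  *%R (Num.conj \; *%R) l2inner (conj l2innerPl l2innerPr).

Lemma l2inner_herm f g : l2inner f g = (-1) ^+ false * Num.conj (l2inner g f).
Proof. by rewrite expr0 mul1r -l2inner_conj. Qed.

HB.instance Definition _ := @isHermitianSesquilinear.Build R[i] l2 false
  (@Num.conj R[i]) l2inner l2inner_herm.

Definition l2sqn f : R := limn (series (fun n => sqn (f n))).

Lemma l2inner_diag f : l2inner f f = (l2sqn f)%:C.
Proof.
have h := sqsum_cvg (l2_sqsum f).
rewrite /l2inner (@csumP _ _ (l2sqn f) 0)//.
- rewrite [X in series X](_ : _ = fun n => sqn (f n))//.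
  by apply/funext => n; rewrite mulr_conjC.
- rewrite [X in X @ _ --> _](_ : _ = fun=> 0); first exact: cvg_cst.
  by apply/funext => N; rewrite /series /= big1// => n _; rewrite mulr_conjC.
Qed.

Lemma l2sqn_ge_sum f N : \sum_(n < N) sqn (f n) <= l2sqn f.
Proof.
have := nondecreasing_cvgn_le _ (sqsum_cvg (l2_sqsum f)) N.
rewrite /series /= big_mkord; apply; apply: nondecreasing_series => n _ _.
exact: sqn_ge0.
Qed.

Lemma l2sqn_le f M : (forall N, \sum_(n < N) sqn (f n) <= M) -> l2sqn f <= M.
Proof.
move=> fM; apply: limr_le; first exact: sqsum_cvg (l2_sqsum f).
by near=> N; rewrite /series /= big_mkord.
Unshelve. all: by end_near. Qed.

Lemma l2sqn_ge0 f : 0 <= l2sqn f.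
Proof. by have := l2sqn_ge_sum f 0; rewrite big_ord0. Qed.

Lemma sqn_le_l2sqn f n : sqn (f n) <= l2sqn f.
Proof.
apply: le_trans (l2sqn_ge_sum f n.+1); rewrite big_ord_recr /= lerDr.
by apply: sumr_ge0 => i _; exact: sqn_ge0.
Qed.

Lemma l2sqn_eq0 f : l2sqn f = 0 -> f = 0.
Proof.
move=> f0; apply: l2_ext => n; apply: sqn_eq0.
by apply/eqP; rewrite eq_le sqn_ge0 -f0 sqn_le_l2sqn.
Qed.

Lemma l2inner_gt0 f : f != 0 -> 0 < l2inner f f.
Proof.
move=> f0; rewrite l2inner_diag ltcR lt_def l2sqn_ge0 andbT.
by apply: contra_neq f0; exact: l2sqn_eq0.
Qed.

HB.instance Definition _ := @isDotProduct.Build R[i] l2 l2inner l2inner_gt0.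

Lemma l2innerZl (l : R[i]) f g : l2inner (l *: f) g = l * l2inner f g.
Proof. exact: (linearZl_LR (l2inner : {bilinear l2 -> l2 -> R[i] | _ & _})). Qed.

Lemma l2innerZr (l : R[i]) f g : l2inner f (l *: g) = Num.conj l * l2inner f g.
Proof. exact: (linearZr_LR (l2inner : {bilinear l2 -> l2 -> R[i] | _ & _})). Qed.

Lemma l2sqn_comb (r s : R) f g : l2sqn (r%:C *: f + s%:C *: g) =
  r ^+ 2 * l2sqn f + s ^+ 2 * l2sqn g + 2 * r * s * complex.Re (l2inner f g).
Proof.
apply: (@complexI R); rewrite -l2inner_diag.
rewrite l2innerPl !l2innerPr !l2innerZl !l2innerZr !(l2inner_conj g f) !l2inner_diag.
case: (l2inner f g) => p q /=; apply/eqP; rewrite eq_complex /=.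
by apply/andP; split; apply/eqP; ring.
Qed.

Definition l2norm f : R[i] := (Num.sqrt (l2sqn f))%:C.

Lemma l2normD f g : l2norm (f + g) <= l2norm f + l2norm g.
Proof.
rewrite -rmorphD lecR.
set p := Num.sqrt (l2sqn f); set q := Num.sqrt (l2sqn g).
have p2 : p ^+ 2 = l2sqn f by rewrite sqr_sqrtr ?l2sqn_ge0.
have q2 : q ^+ 2 = l2sqn g by rewrite sqr_sqrtr ?l2sqn_ge0.
have p0 : 0 <= p by exact: sqrtr_ge0.
have q0 : 0 <= q by exact: sqrtr_ge0.
rewrite -(@ler_pXn2r _ 2) ?nnegrE ?sqrtr_ge0 ?addr_ge0// sqr_sqrtr ?l2sqn_ge0//.
have := l2sqn_comb 1 1 f g; rewrite !scale1r => ->.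
rewrite -p2 -q2 expr1n !mul1r mulr1.
suff : complex.Re (l2inner f g) <= p * q by nra.
have [g0|gn0] := eqVneq g 0.
  by rewrite g0 -(scale0r (0 : l2)) l2innerZr rmorph0 mul0r mulr_ge0.
have [f0|fn0] := eqVneq f 0.
  by rewrite f0 -(scale0r (0 : l2)) l2innerZl mul0r mulr_ge0.
have gt0 h : h != 0 -> 0 < Num.sqrt (l2sqn h).
  move=> h0; rewrite sqrtr_gt0 lt_def l2sqn_ge0 andbT.
  by apply: contra_neq h0; exact: l2sqn_eq0.
have pp : 0 < p by exact: gt0.
have qq : 0 < q by exact: gt0.
(* Cauchy-Schwarz: with [p = |f|] and [q = |g|], the expansion of [|q f - p g|^2] is
   [2 p q (p q - Re (f | g))]. *)
have := l2sqn_ge0 (q%:C *: f + (- p)%:C *: g).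
rewrite l2sqn_comb -p2 -q2 => h.
have : 0 <= (p * q) * (p * q - complex.Re (l2inner f g)) by nra.
by rewrite pmulr_rge0 ?mulr_gt0// subr_ge0.
Qed.

Lemma l2normZ (l : R[i]) f : l2norm (l *: f) = `|l| * l2norm f.
Proof.
have -> : `|l| = (Num.sqrt (sqn l))%:C by case: l => ? ?; rewrite normc_def.
rewrite /l2norm -rmorphM /= -sqrtrM ?sqn_ge0//; congr (Num.sqrt _)%:C.
apply: (@complexI R); rewrite -l2inner_diag.
by rewrite l2innerZl l2innerZr mulrA mulr_conjC l2inner_diag rmorphM.
Qed.

Lemma l2norm_eq0 f : l2norm f = 0 -> f = 0.
Proof.
move=> [/eqP]; rewrite sqrtr_eq0 => h; apply: l2sqn_eq0.
by apply/eqP; rewrite eq_le l2sqn_ge0 h.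
Qed.

HB.instance Definition _ := Lmodule_isNormed.Build R[i] l2
  l2normD l2normZ l2norm_eq0.

End L2space.

(* Otherwise [/=] turns the real part of an inner product into a limit. *)
Arguments csum {R} a : simpl never.

(** * Convergence expressed through real-valued norms *)

Section NormRTopology.
Variables (R : realType) (X : normedModType R[i]).

Lemma gt0_complexE (e : R[i]) : 0 < e -> e = (complex.Re e)%:C /\ 0 < complex.Re e.
Proof. by case: e => p q; rewrite ltcE /= => /andP[/eqP q0 p0]; split=> //; rewrite q0. Qed.

Lemma cvg_normR_lt {T} {F : set_system T} {FF : Filter F} (f : T -> X) (y : X) :
  f @ F --> y <-> forall e : R, 0 < e -> \forall t \near F, normR (y - f t) < e.
Proof.
rewrite cvgrPdist_lt; split=> h e e0.
- have /h : 0 < e%:C by rewrite ltcR.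
  by apply: filterS => t; rewrite normRE ltcR.
- have [-> /h] := gt0_complexE e0.
  by apply: filterS => t; rewrite normRE ltcR.
Qed.

Lemma cvg_normR0 {T} {F : set_system T} {FF : Filter F} (f : T -> X) (y : X) :
  f @ F --> y <-> (normR (f t - y) @[t --> F] --> (0 : R)).
Proof.
rewrite cvg_normR_lt cvgrPdist_lt; split=> h e e0; have := h e e0;
  apply: filterS => t; rewrite sub0r normrN ger0_norm ?normR_ge0//;
  by rewrite /normR distrC.
Qed.

Lemma normRN (x : X) : normR (- x) = normR x.
Proof. by rewrite /normR normrN. Qed.

Lemma normRBC (x y : X) : normR (x - y) = normR (y - x).
Proof. by rewrite /normR distrC. Qed.

Lemma normRZr (r : R) (x : X) : normR (r%:C *: x) = `|r| * normR x.
Proof. by rewrite normRZ normc_def /= expr0n /= addr0 sqrtr_sqr. Qed.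

Lemma ler_normRB_add (x y z : X) : normR (x - z) <= normR (x - y) + normR (y - z).
Proof. by rewrite -[x - z](subrKA y) ler_normRD. Qed.

Lemma ler_dist_normR (x y : X) : `|normR x - normR y| <= normR (x - y).
Proof.
have := ler_normRB_add x y 0; have := ler_normRB_add y x 0.
by rewrite !subr0 (normRBC y x) ler_norml => ? ?; apply/andP; split; lra.
Qed.

End NormRTopology.

Lemma cvg_sumR (R : realType) {T} {F : set_system T} {FF : Filter F} (I : Type)
    (r : seq I) (f : I -> T -> R) (l : I -> R) :
  (forall i, f i @ F --> l i) ->
  (fun t => \sum_(i <- r) f i t) @ F --> \sum_(i <- r) l i.
Proof. by move=> fl; apply: cvg_big => //; exact: add_continuous. Qed.

(** * Completeness of [l2] *)

Section L2complete.
Variable R : realType.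
Implicit Types f g x y : l2 R.

Lemma normR_l2 f : normR f = Num.sqrt (l2sqn f).
Proof. by []. Qed.

Lemma normR_l2_sqr f : normR f ^+ 2 = l2sqn f.
Proof. by rewrite normR_l2 sqr_sqrtr ?l2sqn_ge0. Qed.

Lemma Re_le_normR f n : `|complex.Re (f n)| <= normR f.
Proof.
rewrite -(@ler_pXn2r _ 2) ?nnegrE ?normR_ge0// normR_l2_sqr.
apply: le_trans (sqn_le_l2sqn f n).
by rewrite -normrX ger0_norm ?sqr_ge0// /sqn lerDl sqr_ge0.
Qed.

Lemma Im_le_normR f n : `|complex.Im (f n)| <= normR f.
Proof.
rewrite -(@ler_pXn2r _ 2) ?nnegrE ?normR_ge0// normR_l2_sqr.
apply: le_trans (sqn_le_l2sqn f n).
by rewrite -normrX ger0_norm ?sqr_ge0// /sqn lerDr sqr_ge0.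
Qed.

Lemma ball_normR (X : normedModType R[i]) (x y : X) (e : R) :
  ball x e%:C y <-> normR (x - y) < e.
Proof. by rewrite -ball_normE /= normRE ltcR. Qed.

(** A Lipschitz function sends Cauchy filters to Cauchy filters; this is applied to the real and
    imaginary parts of each coordinate. *)
Lemma l2_cauchy_coord (phi : l2 R -> R) (F : set_system (l2 R)) :
  (forall x y, `|phi x - phi y| <= normR (x - y)) ->
  ProperFilter F -> cauchy F -> cvg (phi @ F).
Proof.
move=> phil FF /cauchyP Fc; apply/cauchy_cvgP; apply: cauchy_exP => e e0.
have [|x Fx] := Fc e%:C; first by rewrite ltcR.
exists (phi x); suff : F (phi @^-1` ball (phi x) e) by [].
apply: filterS Fx => y xy; rewrite /= -ball_normE /=.
by apply: (le_lt_trans (phil x y)); apply/(@ball_normR (l2 R)).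
Qed.

(** The candidate [L] is the coordinatewise limit. A bound on [|x - y|] valid for [y] in a set of
    [F] passes to every finite coordinate sum of [x - L], uniformly in the length ([key]). This
    yields both the square summability of [L] and the convergence to it. *)
Lemma l2_complete (F : set_system (l2 R)) : ProperFilter F -> cauchy F -> cvg F.
Proof.
move=> FF Fc.
have cr n : cvg ((fun f : l2 R => complex.Re (f n)) @ F).
  apply: l2_cauchy_coord => // x y; apply: le_trans (Re_le_normR (x - y) n).
  by rewrite l2B; case: (x n) => ? ?; case: (y n).
have ci n : cvg ((fun f : l2 R => complex.Im (f n)) @ F).
  apply: l2_cauchy_coord => // x y; apply: le_trans (Im_le_normR (x - y) n).
  by rewrite l2B; case: (x n) => ? ?; case: (y n).
pose L n : R[i]^o := lim ((fun f : l2 R => complex.Re (f n)) @ F)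
   +i* lim ((fun f : l2 R => complex.Im (f n)) @ F).
have key x (e : R) : F [set y | normR (x - y) <= e] ->
    forall N, \sum_(n < N) sqn (x n - L n) <= e ^+ 2.
  move=> Fx N.
  have c : (fun y : l2 R => \sum_(n < N) sqn (x n - y n)) @ F -->
      \sum_(n < N) sqn (x n - L n).
    apply: cvg_sumR => n.
    rewrite (_ : (fun y => _) = (fun y : l2 R =>
       (complex.Re (x n) - complex.Re (y n)) ^+ 2 +
       (complex.Im (x n) - complex.Im (y n)) ^+ 2)); last first.
      by apply/funext => y; case: (x n) => ? ?; case: (y n).
    rewrite (_ : sqn _ = (complex.Re (x n) - complex.Re (L n)) ^+ 2 +
       (complex.Im (x n) - complex.Im (L n)) ^+ 2); last first.
      by rewrite /sqn; case: (x n) => ? ?.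
    apply: cvgD; rewrite !expr2.
      by apply: cvgM; (apply: cvgB; [exact: cvg_cst|exact: cr]).
    by apply: cvgM; (apply: cvgB; [exact: cvg_cst|exact: ci]).
  rewrite -(cvg_lim _ c)//; apply: limr_le; first by apply/cvg_ex; eexists; exact: c.
  apply: filterS Fx => y /= xy; apply: (le_trans (l2sqn_ge_sum (x - y) N)).
  by rewrite -normR_l2_sqr ler_pXn2r ?nnegrE ?normR_ge0// (le_trans _ xy) ?normR_ge0.
move: (Fc) => /cauchyP Fc'.
have Fb (e : R) : 0 < e -> exists x, F [set y | normR (x - y) <= e].
  move=> e0; have [|x Fx] := Fc' e%:C; first by rewrite ltcR.
  by exists x; apply: filterS Fx => y /ball_normR /ltW.
have LP : L \in @sqsum_pred R.
  have [x Fx] := Fb 1 ltr01; apply/asboolP.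
  have h : sqsum (fun n => x n - L n) by exists (1 ^+ 2) => N; exact: key.
  have := sqsum_comb (-1) h (l2_sqsum x).
  by congr sqsum; apply/funext => n; rewrite mulN1r opprB subrK.
apply/cvg_ex; exists (MkL2 LP).
apply: (@cvg_normR_lt _ _ _ F _ id _).2 => e e0.
have [x Fx] := Fb (e / 3) ltac:(lra).
apply: filterS (Fx) => y /= xy.
apply: (le_lt_trans (ler_normRB_add _ x _)).
have : normR (MkL2 LP - x) <= e / 3.
  rewrite normRBC -(@ler_pXn2r _ 2) ?nnegrE ?normR_ge0//; last lra.
  by rewrite normR_l2_sqr; apply: l2sqn_le => N; exact: key.
lra.
Qed.

HB.instance Definition _ := Uniform_isComplete.Build (l2 R) l2_complete.

Lemma l2_sqr_norm f : `|f| ^+ 2 = l2inner f f.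
Proof. by rewrite l2inner_diag normRE -rmorphXn /= normR_l2_sqr. Qed.

HB.instance Definition _ := CompleteNormedModule_isHilbert.Build R (l2 R)
  l2_sqr_norm.

End L2complete.

Lemma ler_sum_widen (R : numDomainType) (F : nat -> R) (M N : nat) :
  (forall n, 0 <= F n) -> (M <= N)%N -> \sum_(n < M) F n <= \sum_(n < N) F n.
Proof.
move=> F0 MN; rewrite -!(big_mkord xpredT F) (big_cat_nat _ MN)//= lerDl.
by apply: sumr_ge0.
Qed.

(** * Geometric weights and weighted vectors *)

Section Weights.
Variable R : realType.

Definition wt (n : nat) : R := 2^-1 ^+ n.

Lemma wt_gt0 n : 0 < wt n.
Proof. by rewrite exprn_gt0. Qed.

Lemma wt_ge0 n : 0 <= wt n.
Proof. by rewrite exprn_ge0. Qed.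

Lemma wtS n : wt n = 2 * wt n.+1.
Proof. by rewrite /wt exprS mulrA divff ?mul1r. Qed.

Lemma wt_le1 n : wt n <= 1.
Proof. by rewrite exprn_ile1// invf_le1// ler1n. Qed.

Lemma sum_wt_tail (N M : nat) : \sum_(N <= n < M) wt n <= 2 * wt N.
Proof.
have [MN|NM] := leqP M N; first by rewrite big_geq// mulr_ge0 ?wt_ge0//.
suff -> : \sum_(N <= n < M) wt n = 2 * wt N - 2 * wt M.
  by rewrite gerBl mulr_ge0 ?wt_ge0//.
have {NM} := ltnW NM; elim: M => [|M IH].
  by rewrite leqn0 => /eqP ->; rewrite big_geq// subrr.
rewrite leq_eqVlt => /predU1P[<-|NM]; first by rewrite big_geq// subrr.
by rewrite big_nat_recr//= IH// (wtS M); ring.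
Qed.

Lemma sum_wt (N : nat) : \sum_(n < N) wt n <= 2.
Proof. by rewrite -(big_mkord xpredT wt) (le_trans (sum_wt_tail 0 N))// /wt expr0 mulr1. Qed.

Lemma cvg_wt : wt @ \oo --> (0 : R).
Proof. by apply: cvg_expr; rewrite ger0_norm// invf_lt1// ltr1n. Qed.

End Weights.

Section WeightedVectors.
Variable R : realType.
Implicit Types (b : nat -> R[i]) (f g x y : l2 R).

Lemma sqn_real (r : R) (z : R[i]) : sqn (r%:C * z) = r ^+ 2 * sqn z.
Proof. by rewrite sqnM /sqn /= expr0n addr0. Qed.

(** The default value 0 spares a summability proof as argument; [wvecE] gives the true coordinates
    for bounded [b]. *)
Definition wvec b : l2 R := insubd (0 : l2 R) (fun n => (wt R n)%:C * b n).

Lemma wvecE b (C : R) : (forall n, sqn (b n) <= C) ->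
  forall n, wvec b n = (wt R n)%:C * b n.
Proof.
move=> bC n; rewrite /wvec insubdK//; apply/asboolP; exists (C * 2) => N.
have C0 : 0 <= C by apply: le_trans (bC 0); exact: sqn_ge0.
apply: (@le_trans _ _ (\sum_(n < N) C * wt R n)).
  apply: ler_sum => k _; rewrite sqn_real mulrC ler_pM ?sqn_ge0 ?exprn_ge0 ?wt_ge0//.
  by rewrite expr2 ler_piMr ?wt_le1 ?wt_ge0.
by rewrite -mulr_sumr ler_wpM2l// sum_wt.
Qed.

Lemma normR_wvec b (C : R) : (forall n, sqn (b n) <= C) -> normR (wvec b) ^+ 2 <= C * 2.
Proof.
move=> bC; have C0 : 0 <= C by apply: le_trans (bC 0); exact: sqn_ge0.
rewrite normR_l2_sqr; apply: l2sqn_le => N.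
apply: (@le_trans _ _ (\sum_(n < N) C * wt R n)).
  apply: ler_sum => k _; rewrite (wvecE bC) sqn_real mulrC.
  rewrite ler_pM ?sqn_ge0 ?exprn_ge0 ?wt_ge0//.
  by rewrite expr2 ler_piMr ?wt_le1 ?wt_ge0.
by rewrite -mulr_sumr ler_wpM2l// sum_wt.
Qed.

(** The bound [C] makes the tails of the squared norm geometrically small uniformly in [t], so
    continuity of each coordinate is enough. No equicontinuity is available in the application,
    where the frequencies grow with [n]. *)
Lemma wvec_continuous (b : R -> nat -> R[i]) (C : R) :
  (forall t n, sqn (b t n) <= C) ->
  (forall n, continuous (fun t => complex.Re (b t n))) ->
  (forall n, continuous (fun t => complex.Im (b t n))) ->
  continuous (fun t => wvec (b t)).
Proof.
move=> bC br bi s; apply/cvg_normR_lt => e e0.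
have C0 : 0 <= C by apply: le_trans (bC 0 0); exact: sqn_ge0.
(* The squared modulus of a difference of two entries is at most [2 (C + C) = 4 C], and the weights
   from [N] on sum to at most [2 wt N]. *)
have [N hN] : exists N, 4 * C * (2 * wt R N) < e ^+ 2 / 2.
  have : (fun n => 4 * C * (2 * wt R n)) @ \oo --> (4 * C * (2 * 0) : R).
    by apply: cvgMr; apply: cvgMr; exact: cvg_wt.
  rewrite !mulr0 => /cvgrPdist_lt /(_ (e ^+ 2 / 2)); rewrite divr_gt0 ?exprn_gt0//.
  move=> /(_ erefl) [N _ /(_ N)] /=; rewrite leqnn => /(_ erefl).
  by rewrite sub0r normrN => h; exists N; exact: le_lt_trans (ler_norm _) h.
have sq0 : (fun t => \sum_(n < N) sqn (b s n - b t n)) @ s --> \sum_(n < N) (0 : R).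
  apply: cvg_sumR => n.
  rewrite (_ : (fun _ => _) = (fun t => (complex.Re (b s n) - complex.Re (b t n)) ^+ 2
     + (complex.Im (b s n) - complex.Im (b t n)) ^+ 2)); last first.
    by apply/funext => t; case: (b s n) => ? ?; case: (b t n).
  rewrite [X in _ --> X](_ : 0 = (complex.Re (b s n) - complex.Re (b s n)) ^+ 2
     + (complex.Im (b s n) - complex.Im (b s n)) ^+ 2); last first.
    by rewrite !subrr expr0n addr0.
  by apply: cvgD; rewrite !expr2; apply: cvgM; apply: cvgB; try exact: cvg_cst;
    first [exact: (br n s) | exact: (bi n s)].
move: sq0; rewrite big1// => /cvgrPdist_lt /(_ (e ^+ 2 / 2)).
rewrite divr_gt0 ?exprn_gt0// => /(_ erefl); apply: filterS => t.
rewrite sub0r normrN ger0_norm; last by apply: sumr_ge0 => n _; exact: sqn_ge0.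
move=> ht; rewrite -(@ltr_pXn2r _ 2) ?nnegrE ?normR_ge0 ?(ltW e0)//.
rewrite normR_l2_sqr.
apply: (@le_lt_trans _ _ (\sum_(n < N) sqn (b s n - b t n) + 4 * C * (2 * wt R N)));
  last by lra.
apply: l2sqn_le => M.
have term n : sqn ((wvec (b s) - wvec (b t)) n) <= wt R n * sqn (b s n - b t n).
  rewrite l2B !(@wvecE _ C)// -mulrBr sqn_real ler_wpM2r ?sqn_ge0//.
  by rewrite expr2 ler_piMr ?wt_le1 ?wt_ge0//.
have term1 n : sqn ((wvec (b s) - wvec (b t)) n) <= sqn (b s n - b t n).
  by apply: (le_trans (term n)); rewrite ler_piMl ?sqn_ge0 ?wt_le1.
have term2 n : sqn ((wvec (b s) - wvec (b t)) n) <= 4 * C * wt R n.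
  apply: (le_trans (term n)); rewrite [leRHS]mulrC ler_wpM2l ?(ltW (wt_gt0 _ _))//.
  apply: (le_trans (sqnD_le _ _)).
  have -> : sqn (- b t n) = sqn (b t n) by rewrite /sqn; case: (b t n) => ? ? /=; ring.
  by have := bC s n; have := bC t n; lra.
have [MN|NM] := leqP M N.
  apply: (@le_trans _ _ (\sum_(n < N) sqn (b s n - b t n))); last first.
    by rewrite lerDl !mulr_ge0 ?wt_ge0.
  apply: (@le_trans _ _ (\sum_(n < M) sqn (b s n - b t n))).
    by apply: ler_sum => n _; exact: term1.
  by apply: (@ler_sum_widen _ (fun n => sqn (b s n - b t n))) => // n; exact: sqn_ge0.
rewrite -(big_mkord xpredT (fun n => sqn ((wvec (b s) - wvec (b t)) n))).
rewrite -(big_mkord xpredT (fun n => sqn (b s n - b t n))).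
rewrite (big_cat_nat _ (ltnW NM))//=.
apply: lerD; first by apply: ler_sum => n _; exact: term1.
apply: (@le_trans _ _ (\sum_(N <= n < M) 4 * C * wt R n)).
  by apply: ler_sum => n _; exact: term2.
by rewrite -mulr_sumr ler_wpM2l ?mulr_ge0// sum_wt_tail.
Qed.

End WeightedVectors.

(** * Separability of [l2] *)

Section Separability.
Variable R : realType.
Implicit Types (f g x y : l2 R).

Lemma sum_sqn_nth (s : seq R[i]) N :
  \sum_(n < N) sqn (nth 0 s n) <= \sum_(z <- s) sqn z.
Proof.
elim: s N => [|z s IH] [|N]; rewrite ?big_ord0 ?big_nil//.
- rewrite big1// => n _; rewrite nth_nil /sqn /= expr0n addr0//.
- by apply: sumr_ge0 => ? _; exact: sqn_ge0.
- by rewrite big_ord_recl big_cons lerD2l; exact: IH.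
Qed.

Fact finl2_subproof (s : seq R[i]) : (fun n => nth 0 s n : R[i]^o) \in @sqsum_pred R.
Proof. by apply/asboolP; exists (\sum_(z <- s) sqn z) => N; exact: sum_sqn_nth. Qed.

Definition finl2 (s : seq R[i]) : l2 R := MkL2 (finl2_subproof s).

Lemma denseP (S : set (l2 R)) :
  (forall x (e : R), 0 < e -> exists2 y, S y & normR (x - y) < e) -> dense S.
Proof.
move=> h O [x Ox] oO.
have /nbhs_ballP[e e0 xeO] : nbhs x O by exact: open_nbhs_nbhs.
have [ee e'0] := gt0_complexE e0.
have [y Sy xy] := h x _ e'0; exists y; split=> //.
by apply: xeO; rewrite ee; apply/(@ball_normR R (l2 R)).
Qed.

Definition rat_seq (s : seq (rat * rat)) : seq R[i] :=
  [seq ratr p.1 +i* ratr p.2 | p <- s].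

Lemma rat_approx (z : R[i]) (d : R) : 0 < d ->
  exists p : rat * rat, sqn (z - (ratr p.1 +i* ratr p.2)) <= d.
Proof.
move=> d0; set e := Num.sqrt (d / 2).
have e0 : 0 < e by rewrite sqrtr_gt0 divr_gt0.
have [p /andP[p1 p2]] : exists p : rat, complex.Re z - e < ratr p < complex.Re z + e.
  have [|p] := @rat_in_itvoo R (complex.Re z - e) (complex.Re z + e); first by lra.
  by rewrite in_itv; exists p.
have [q /andP[q1 q2]] : exists q : rat, complex.Im z - e < ratr q < complex.Im z + e.
  have [|q] := @rat_in_itvoo R (complex.Im z - e) (complex.Im z + e); first by lra.
  by rewrite in_itv; exists q.
exists (p, q); have e2 : e ^+ 2 = d / 2 by rewrite sqr_sqrtr// divr_ge0// ltW.
move: p1 p2 q1 q2 e2; case: z => a b /=; rewrite /sqn /=; nra.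
Qed.

(** Cut [x] off where its tail is below [e^2 / 2], then approximate the remaining entries by complex
    numbers with rational parts. *)
Lemma finl2_rat_dense : dense (range (fun s => finl2 (rat_seq s))).
Proof.
apply: denseP => x e e0.
have e2 : 0 < e ^+ 2 by rewrite exprn_gt0.
have [N hN] : exists N, l2sqn x - \sum_(n < N) sqn (x n) < e ^+ 2 / 2.
  have /cvgrPdist_lt /(_ (e ^+ 2 / 2)) := sqsum_cvg (l2_sqsum x).
  rewrite divr_gt0// => /(_ erefl) [N _ /(_ N)] /=; rewrite leqnn => /(_ erefl) h.
  by exists N; apply: le_lt_trans h; rewrite /series /= big_mkord ler_norm.
(* Since the weights sum to at most 2, these errors add up to at most [e^2 / 4]. *)
have d0 n : 0 < wt R n * (e ^+ 2 / 8) by rewrite mulr_gt0 ?wt_gt0 ?divr_gt0.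
pose q n := sval (cid (rat_approx (x n) (d0 n))).
have qP n : sqn (x n - (ratr (q n).1 +i* ratr (q n).2)) <= wt R n * (e ^+ 2 / 8).
  exact: svalP (cid (rat_approx (x n) (d0 n))).
exists (finl2 (rat_seq (mkseq q N))); first by exists (mkseq q N).
set y := finl2 _.
have y1 n : (n < N)%N -> y n = ratr (q n).1 +i* ratr (q n).2.
  move=> nN; rewrite /y /= (nth_map (0, 0)) ?size_mkseq// nth_mkseq//.
have y2 n : (N <= n)%N -> y n = 0.
  by move=> nN; rewrite /y /= nth_default// size_map size_mkseq.
rewrite -(@ltr_pXn2r _ 2) ?nnegrE ?normR_ge0 ?(ltW e0)// normR_l2_sqr.
apply: (@le_lt_trans _ _ (e ^+ 2 / 8 * 2 + (l2sqn x - \sum_(n < N) sqn (x n)))); last lra.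
apply: l2sqn_le => M.
apply: (@le_trans _ _ (\sum_(n < N + M) sqn ((x - y) n))).
  by apply: (@ler_sum_widen _ (fun n => sqn ((x - y) n))) => [n|];
    [exact: sqn_ge0|exact: leq_addl].
have := l2sqn_ge_sum x (N + M).
rewrite -(big_mkord xpredT (fun n => sqn ((x - y) n))).
rewrite -!(big_mkord xpredT (fun n => sqn (x n))).
rewrite !(@big_cat_nat _ _ _ N 0 (N + M))//= ?leq_addr//.
have -> : \sum_(N <= n < N + M) sqn ((x - y) n) = \sum_(N <= n < N + M) sqn (x n).
  by apply: eq_big_nat => n /andP[Nn _]; rewrite l2B y2// subr0.
have : \sum_(0 <= n < N) sqn ((x - y) n) <= e ^+ 2 / 8 * 2.
  apply: (@le_trans _ _ (\sum_(0 <= n < N) wt R n * (e ^+ 2 / 8))).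
    by apply: ler_sum_nat => n /andP[_ nN]; rewrite l2B y1.
  rewrite -mulr_suml mulrC ler_wpM2l//; first by rewrite divr_ge0// ltW.
  by rewrite big_mkord sum_wt.
by set a := bigop _ _ _; set b := bigop _ _ _; set c := bigop _ _ _; lra.
Qed.

Lemma l2_separable : separable_space (l2 R).
Proof.
exists (range (fun s => finl2 (rat_seq s))); split; last exact: finl2_rat_dense.
exact: card_le_trans (card_image_le _ _) (countableP _).
Qed.

End Separability.

(** * The diagonal embedding and the canonical basis *)

Section DiagonalEmbedding.
Variable R : realType.
Implicit Types (f g x y : l2 R).

Fact diag_subproof f : (fun n => (wt R n)%:C * f n : R[i]^o) \in @sqsum_pred R.
Proof.
apply/asboolP; have [M fM] := l2_sqsum f; exists M => N; apply: le_trans (fM N).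
apply: ler_sum => n _; rewrite sqn_real ler_piMl ?sqn_ge0//.
by rewrite expr_le1 ?wt_le1 ?wt_ge0//.
Qed.

Definition diag f : l2 R := MkL2 (diag_subproof f).

Lemma diagE f n : diag f n = (wt R n)%:C * f n.
Proof. by []. Qed.

Lemma diag_linear : linear diag.
Proof. by move=> l f g; apply: l2_ext => n; rewrite /= mulrDr mulrCA. Qed.

Lemma diag_inj : injective diag.
Proof.
move=> f g fg; apply: l2_ext => n.
have : diag f n = diag g n by rewrite fg.
rewrite !diagE => /mulfI; apply; apply/eqP => -[/eqP].
by rewrite gt_eqF// wt_gt0.
Qed.

Lemma normR_diag f : normR (diag f) <= normR f.
Proof.
rewrite -(@ler_pXn2r _ 2) ?nnegrE ?normR_ge0// !normR_l2_sqr.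
apply: l2sqn_le => N; apply: le_trans (l2sqn_ge_sum f N).
apply: ler_sum => n _; rewrite diagE sqn_real ler_piMl ?sqn_ge0//.
by rewrite expr_le1 ?wt_le1 ?wt_ge0//.
Qed.

Lemma diag_continuous : continuous diag.
Proof.
move=> f; apply: (cvg_normR_lt (FF := nbhs_filter f) _ _).2 => e e0.
have idf : (id : l2 R -> l2 R) @ f --> f by exact: cvg_id.
have := (cvg_normR_lt (FF := nbhs_filter f) _ _).1 idf e e0.
apply: filterS => g; apply: le_lt_trans.
have -> : diag f - diag g = diag (f - g).
  by apply: l2_ext => n; rewrite l2B !diagE l2B mulrBr.
exact: normR_diag.
Qed.

(** Every finitely supported vector is in the range, by dividing its entries by the weights, and
    such vectors are dense already. *)
Lemma diag_dense : dense (range diag).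
Proof.
move=> O O0 oO; have [y [Oy [s _ sy]]] := finl2_rat_dense O0 oO.
exists y; split=> //; rewrite -sy.
exists (finl2 (mkseq (fun n => ((wt R n)^-1)%:C * nth 0 (rat_seq R s) n) (size s))) => //.
apply: l2_ext => n; rewrite diagE /=; have [ns|sn] := ltnP n (size s).
  rewrite nth_mkseq// mulrA -rmorphM /= divff ?mul1r// gt_eqF// wt_gt0//.
by rewrite !nth_default ?mulr0// ?size_mkseq// size_map.
Qed.

Definition diag_embedding : dense_embedding (l2 R) (l2 R) :=
  DenseEmbedding diag_linear diag_inj diag_continuous diag_dense.

(** The weights are real, so [diag] is self-adjoint. Hence, in Riesz coordinates, the inclusion of
    [H] in [V'] is [diag] once more. *)
Lemma inner_diag f g : l2inner (diag f) g = l2inner f (diag g).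
Proof.
rewrite /l2inner; congr csum; apply/funext => n.
rewrite !diagE rmorphM /= mulrCA mulrA; congr (_ * _ * _).
by apply/eqP; rewrite eq_complex /= oppr0 !eqxx.
Qed.

Definition basis n : l2 R := finl2 (rcons (nseq n 0) 1).

Lemma basisE n k : basis n k = (k == n)%:R.
Proof.
by rewrite /= nth_rcons size_nseq nth_nseq; case: ltngtP => // _; rewrite if_same.
Qed.

Lemma inner_basis f n : l2inner f (basis n) = f n.
Proof.
have h (phi : R[i] -> R) : phi 0 = 0 ->
    series (fun k => phi (f k * Num.conj (basis n k))) @ \oo --> phi (f n).
  move=> p0; apply: (@cvg_near_cst _ _ _ _ _); exists n.+1 => //= N nN.
  change (\sum_(0 <= k < N) phi (f k * Num.conj (basis n k)) = phi (f n)).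
  rewrite (bigD1_seq n) ?iota_uniq ?mem_index_iota//.
  rewrite basisE eqxx rmorph1 mulr1 big1 => [|k kn]; first exact: addr0.
  by rewrite basisE (negbTE kn) rmorph0 mulr0.
by rewrite /l2inner (csumP (h (@complex.Re R) erefl) (h (@complex.Im R) erefl)); case: (f n).
Qed.

End DiagonalEmbedding.

(** * Almost-everywhere Lebesgue integrals *)

Section AlmostEverywhere.
Variable R : realType.
Local Notation mu := (@lebesgue_measure R).
Implicit Types P Q S U : R -> Prop.

Lemma aeS P Q : (forall t, P t -> Q t) ->
  {ae mu, forall t, P t} -> {ae mu, forall t, Q t}.
Proof.
by move=> PQ hP; apply: (@filterS _ _ (ae_filter_ringOfSetsType mu)) hP.
Qed.

Lemma aeS2 P Q S : (forall t, P t -> Q t -> S t) ->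
  {ae mu, forall t, P t} -> {ae mu, forall t, Q t} -> {ae mu, forall t, S t}.
Proof.
by move=> PQS hP hQ; apply: (@filterS2 _ _ (ae_filter_ringOfSetsType mu)) hP hQ.
Qed.

Lemma aeS3 P Q S U : (forall t, P t -> Q t -> S t -> U t) ->
  {ae mu, forall t, P t} -> {ae mu, forall t, Q t} -> {ae mu, forall t, S t} ->
  {ae mu, forall t, U t}.
Proof.
by move=> PQSU hP hQ hS;
  apply: (@filterS3 _ _ (ae_filter_ringOfSetsType mu)) hP hQ hS.
Qed.

End AlmostEverywhere.

Section AeIntegral.
Variables (R : realType) (D : set R).
Local Notation mu := (@lebesgue_measure R).
Hypotheses (mD : measurable (D : set (measurableTypeR R))) (Dfin : (mu D < +oo)%E).
Implicit Types (f g h : R -> R) (I J : R).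

(* [lebesgue_measure] is defined on Borel sets only, where an almost everywhere
   limit of measurable functions need not be measurable; integrals are therefore
   taken through a measurable representative. *)
Definition ae_integral f I := exists F : R -> R,
  [/\ mu.-integrable D (EFin \o F), {ae mu, forall t, D t -> F t = f t} &
   \int[mu]_(t in D) F t = I].

Lemma ae_integral_integrable f : mu.-integrable D (EFin \o f) ->
  ae_integral f (\int[mu]_(t in D) f t).
Proof. by move=> fi; exists f; split=> //; apply: aeW. Qed.

Lemma ae_integral_ae_eq f g I : {ae mu, forall t, D t -> f t = g t} ->
  ae_integral f I -> ae_integral g I.
Proof.
move=> fg [F [iF Ff FI]]; exists F; split => //.
by apply: aeS2 fg Ff => t fg Ff Dt; rewrite Ff// fg.
Qed.

Lemma ae_integral_eq f g I : (forall t, D t -> f t = g t) ->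
  ae_integral f I -> ae_integral g I.
Proof. by move=> fg; apply: ae_integral_ae_eq; exact: aeW. Qed.

Lemma ae_integral_uniq f I J : ae_integral f I -> ae_integral f J -> I = J.
Proof.
move=> [F [iF Ff <-]] [G [iG Gf <-]]; congr fine; apply: ae_eq_integral => //.
- exact: measurable_int iF.
- exact: measurable_int iG.
- by apply: aeS2 Ff Gf => t Ff Gf Dt /=; rewrite Ff// Gf.
Qed.

Lemma ae_integral_comb (a b : R) f g I J : ae_integral f I -> ae_integral g J ->
  ae_integral (fun t => a * f t + b * g t) (a * I + b * J).
Proof.
move=> [F [iF Ff <-]] [G [iG Gf <-]].
have iaF := integrableZl mD a iF; have ibG := integrableZl mD b iG.
exists (fun t => a * F t + b * G t); split.
- by have := integrableD mD iaF ibG.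
- by apply: aeS2 Ff Gf => t Ff Gf Dt; rewrite Ff// Gf.
- by rewrite RintegralD// !RintegralZl.
Qed.

Lemma ae_integral_sum (T : Type) (s : seq T) (f : T -> R -> R) (I : T -> R) :
  (forall x, ae_integral (f x) (I x)) ->
  ae_integral (fun t => \sum_(x <- s) f x t) (\sum_(x <- s) I x).
Proof.
move=> fI; elim: s => [|x s IH].
  rewrite big_nil; have -> : (fun t => \sum_(x <- [::]) f x t) = cst 0.
    by apply/funext => t; rewrite big_nil.
  have := @ae_integral_integrable (cst 0) (integrable0 _ _).
  by rewrite /Rintegral integral0.
have := ae_integral_comb 1 1 (fI x) IH; rewrite big_cons !mul1r.
by apply: ae_integral_eq => t _; rewrite big_cons !mul1r.
Qed.

Lemma ae_integral_le f g I J : {ae mu, forall t, D t -> f t <= g t} ->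
  ae_integral f I -> ae_integral g J -> I <= J.
Proof.
move=> fg [F [iF Ff <-]] [G [iG Gf <-]].
rewrite -subr_ge0 -RintegralB//.
have iGF := integrableB mD iG iF; have mGF := measurable_int _ iGF.
(* The order holds only almost everywhere; the positive part of the difference has the same integral
   and is nonnegative everywhere. *)
rewrite (_ : \int[mu]_(t in D) (G t - F t) = \int[mu]_(t in D) Num.max (G t - F t) 0).
  by apply: Rintegral_ge0 => t _; rewrite le_max lexx orbT.
congr fine; apply: ae_eq_integral => //.
  apply/measurable_EFinP; apply: measurable_maxr => //.
  exact/measurable_EFinP.
apply: aeS3 fg Ff Gf => t fg Ff Gf Dt; congr (_%:E).
by rewrite max_l// subr_ge0 Ff// Gf// fg.
Qed.

Lemma ae_integral_bounded f (C : R) : measurable_fun (T := measurableTypeR R) D f ->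
  (forall t, D t -> `|f t| <= C) -> ae_integral f (\int[mu]_(t in D) f t).
Proof.
move=> mf fC; apply: ae_integral_integrable.
apply: measurable_bounded_integrable => //.
exists C; split; first exact: num_real.
by move=> x Cx t Dt; apply: (le_trans (fC _ Dt)); exact: ltW.
Qed.

Lemma ae_integral_mul_bounded (theta : R -> R) f I (C : R) :
  measurable_fun (T := measurableTypeR R) D theta -> (forall t, `|theta t| <= C) ->
  ae_integral f I ->
  exists J, ae_integral (fun t => theta t * f t) J.
Proof.
move=> mth thC [F [iF Ff _]].
have mF : measurable_fun (T := measurableTypeR R) D F.
  by apply/measurable_EFinP; exact: measurable_int iF.
have C0 : 0 <= C by apply: le_trans (thC 0).
exists (\int[mu]_(t in D) (theta t * F t)), (fun t => theta t * F t); split => //.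
- apply: (le_integrable mD _ _ (integrableZl mD C iF)).
    by apply/measurable_EFinP; exact: measurable_funM.
  by move=> t Dt; rewrite /= lee_fin !normrM ler_wpM2r// (ger0_norm C0).
- by apply: aeS Ff => t Ff Dt; rewrite Ff.
Qed.

Lemma ae_integral_cvg0 (f : nat -> R -> R) (I : nat -> R) h J :
  (forall n, ae_integral (f n) (I n)) -> ae_integral h J ->
  (forall n t, D t -> `|f n t| <= h t) ->
  (forall t, D t -> f n t @[n --> \oo] --> (0 : R)) ->
  I @ \oo --> (0 : R).
Proof.
move=> fI [H [iH Hh _]] fh f0.
pose F n := sval (cid (fI n)).
have FP n : [/\ mu.-integrable D (EFin \o F n),
    {ae mu, forall t, D t -> F n t = f n t} & \int[mu]_(t in D) F n t = I n].
  exact: svalP (cid (fI n)).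
(* The countably many exceptional sets are merged into one. *)
have aeF : {ae mu, forall t n, D t -> F n t = f n t}.
  by apply/ae_foralln => n; have [_ + _] := FP n.
have [] := @dominated_convergence _ _ _ mu D mD (fun n => EFin \o F n) (cst 0%E)
  (EFin \o H).
- by move=> n; have [iF _ _] := FP n; exact: measurable_int iF.
- exact: measurable_cst.
- apply: aeS aeF => t Ft Dt.
  rewrite (_ : (fun n => _) = EFin \o (fun n => f n t)).
    by apply: cvg_EFin; [exact: nearW|exact: f0].
  by apply/funext => n /=; rewrite Ft.
- exact: iH.
- by apply: aeS2 aeF Hh => t Ft Ht n Dt; rewrite /= lee_fin Ft// Ht// fh.
move=> _ _; rewrite integral0 => /fine_cvg; rewrite /= (_ : _ \o _ = I)//.
by apply/funext => n /=; have [_ _ <-] := FP n.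
Qed.

End AeIntegral.

Section NonMeasurableMonotone.
Local Open Scope ereal_scope.
Import HBNNSimple.

(** The integral of a nonnegative function is a supremum over the simple functions below it, hence
    monotone even without measurability. The integrals in [L2] and [has_bochner_integral] involve
    functions that are only almost everywhere limits of measurable ones. *)
Lemma ge0_le_integral_nonmeasurable (R : realType) (D : set R) (f g : R -> \bar R) :
  (forall x, D x -> 0 <= f x) -> (forall x, D x -> f x <= g x) ->
  \int[@lebesgue_measure R]_(x in D) f x <= \int[@lebesgue_measure R]_(x in D) g x.
Proof.
move=> f0 fg; have g0 x : D x -> 0 <= g x by move=> Dx; apply: le_trans (fg _ Dx); exact: f0.
rewrite ge0_integralE// ge0_integralE//; apply: le_ereal_sup => _ [h /= hf <-].
exists h => // x; apply: le_trans (hf x) _; rewrite /patch.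
by case: ifPn => // /set_mem; exact: fg.
Qed.
End NonMeasurableMonotone.

(** * Bochner integrals under real functionals *)

Section BochnerFunctional.
Variables (R : realType) (X : normedModType R[i]).
Local Notation mu := (@lebesgue_measure R).
Implicit Types (s f : R -> X) (l : X -> R).

(** Real linearity admits real and imaginary parts of coordinates, of inner products and of values
    of functionals; vector-valued integrals are then studied through integrals in [R]. *)
Definition real_functional l := [/\ forall x y, l (x + y) = l x + l y,
  forall (r : R) x, l (r%:C *: x) = r * l x &
  exists2 C : R, 0 <= C & forall x, `|l x| <= C * normR x].

Lemma real_functional0 l : real_functional l -> l 0 = 0.
Proof. by move=> [_ lZ _]; rewrite -(scale0r (0 : X)) lZ mul0r. Qed.

Lemma real_functionalB l x y : real_functional l -> l (x - y) = l x - l y.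
Proof.
move=> [lD lZ _]; rewrite lD -[- y]scaleN1r (_ : -1 = (-1)%:C) ?lZ ?mulN1r//.
by rewrite rmorphN1.
Qed.

Lemma real_functional_sum l (T : Type) (r : seq T) (x : T -> X) :
  real_functional l -> l (\sum_(i <- r) x i) = \sum_(i <- r) l (x i).
Proof.
move=> lr; elim: r => [|i r IH]; first by rewrite !big_nil real_functional0.
by have [lD _ _] := lr; rewrite !big_cons lD IH.
Qed.

Lemma real_functional_cvg l {T} {F : set_system T} {FF : Filter F} (f : T -> X) x :
  real_functional l -> f @ F --> x -> l (f t) @[t --> F] --> l x.
Proof.
move=> lr fx; have [_ _ [C C0 lC]] := lr.
apply/cvgrPdist_le => e e0.
have e1 : 0 < e / (C + 1) by rewrite divr_gt0// ltr_wpDl.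
have /cvg_normR_lt /(_ _ e1) := fx; apply: filterS => t h.
rewrite -real_functionalB//; apply: (le_trans (lC _)).
move: h => /ltW; rewrite ler_pdivlMr ?ltr_wpDl// => h.
have := normR_ge0 (x - f t); nra.
Qed.

(** Any [phi] is allowed: preimages are finite unions of intersections of level sets. *)
Lemma simple_comp2_measurable s s' (phi : X -> X -> R) (D : set R) :
  simple_fun s -> simple_fun s' ->
  measurable_fun (T := measurableTypeR R) D (fun t => phi (s t) (s' t)).
Proof.
move=> [fs ms] [fs' ms'] mD Y _; apply: measurableI => //.
rewrite (_ : _ @^-1` _ = \bigcup_(x in range s)
    \bigcup_(y in range s' `&` [set y | Y (phi x y)])
      (s @^-1` [set x] `&` s' @^-1` [set y])).
  apply: fin_bigcup_measurable => // x _.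
  apply: fin_bigcup_measurable; first exact: finite_setIl.
  by move=> y _; apply: measurableI; [exact: ms|exact: ms'].
apply/seteqP; split=> t /=.
  move=> Yt; exists (s t); first by exists t.
  by exists (s' t) => //; split => //; exists t.
by move=> [x _ [y [_ Yxy] [/= -> ->]]].
Qed.

Lemma simple_comp_measurable s (phi : X -> R) (D : set R) : simple_fun s ->
  measurable_fun (T := measurableTypeR R) D (fun t => phi (s t)).
Proof. by move=> ss; exact: (simple_comp2_measurable (fun x _ => phi x) ss ss). Qed.

Variable D : set R.
Hypotheses (mD : measurable (D : set (measurableTypeR R))) (Dfin : (mu D < +oo)%E).

Lemma ae_integral_indic (A : set R) : measurable A ->
  ae_integral D (\1_A : R -> R) (fine (mu (D `&` A))).
Proof.
move=> mA.
have -> : fine (mu (D `&` A)) = \int[mu]_(t in D) (\1_A t : R).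
  by rewrite /Rintegral integral_indic// setIC.
apply: (ae_integral_bounded mD Dfin (C := 1)).
  by apply: measurable_indic; exact: mA.
by move=> t _; rewrite indicE; case: (_ \in _); rewrite ?normr1 ?normr0.
Qed.

Lemma simple_integral_functional l s : real_functional l -> simple_fun s ->
  ae_integral D (fun t => l (s t)) (l (simple_integral D s)).
Proof.
move=> lr [fs ms]; have [lD lZ _] := lr.
rewrite /simple_integral fsbig_finite// real_functional_sum//.
have hx x : ae_integral D (fun t => l x * \1_(s @^-1` [set x]) t)
    (l ((fine (mu (D `&` s @^-1` [set x])))%:C *: x)).
  have := ae_integral_comb mD (l x) 0 (ae_integral_indic (ms x)) (ae_integral_indic (ms x)).
  rewrite lZ [X in ae_integral _ _ X](_ : _ = fine (mu (D `&` s @^-1` [set x])) * l x).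
    by apply: ae_integral_eq => t _; rewrite mul0r addr0.
  by rewrite mul0r addr0 mulrC.
have := ae_integral_sum mD (finmap.enum_fset (fset_set (range s))) hx.
apply: ae_integral_eq => t _.
rewrite (bigD1_seq (s t)) ?finmap.fset_uniq//=; last first.
  by rewrite in_fset_set// inE; exists t.
rewrite indicE mem_set// mulr1 big1 ?addr0// => x xs.
by rewrite indicE memNset ?mulr0//= => /esym/eqP; rewrite (negbTE xs).
Qed.

(** Off a null set [N], [f] is a limit of simple functions, so [F], which is [l (f t)] cut off on
    [N], is measurable. The integrals of [l (s' n t)] converge to [l I] by continuity of [l], and to
    the integral of [F] because the error is dominated by [C * G n]. *)
Lemma bochner_functional l f I : real_functional l -> has_bochner_integral D f I ->
  ae_integral D (fun t => l (f t)) (l I).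
Proof.
move=> lr [[s [ss [N [mN N0 sN]]]] [s' [ss' s'f s'I]]].
have [_ _ [C C0 lC]] := lr.
have sf t : D t -> ~ N t -> s n t @[n --> \oo] --> f t.
  by move=> Dt Nt; apply: contrapT => h; apply: Nt; apply: sN => /= /(_ Dt).
have mNC : measurable (~` N : set (measurableTypeR R)) by exact: measurableC.
pose F t : R := \1_(~` N) t * l (f t).
have mF : measurable_fun (T := measurableTypeR R) D F.
  apply: (@measurable_fun_cvg _ (measurableTypeR R) R D
     (fun n t => \1_(~` N) t * l (s n t))).
    move=> n; apply: measurable_funM; first by apply: measurable_indic; exact: mNC.
    exact: simple_comp_measurable.
  move=> t Dt; rewrite /F indicE; case: (boolP (t \in ~` N)) => [/set_mem Nt|_].
    by apply: cvgMl_tmp; apply: real_functional_cvg => //; exact: sf.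
  by rewrite mul0r; under eq_fun do rewrite mul0r; exact: cvg_cst.
pose G n t : R := \1_(~` N) t * normR (f t - s' n t).
have G0 n t : 0 <= G n t by rewrite mulr_ge0// ?normR_ge0// indicE ler0n.
have mG n : measurable_fun (T := measurableTypeR R) D (G n).
  apply: (@measurable_fun_cvg _ (measurableTypeR R) R D
     (fun m t => \1_(~` N) t * normR (s m t - s' n t))).
    move=> m; apply: measurable_funM; first by apply: measurable_indic; exact: mNC.
    exact: (simple_comp2_measurable (fun x y => normR (x - y))).
  move=> t Dt; rewrite /G indicE; case: (boolP (t \in ~` N)) => [/set_mem Nt|_].
    apply: cvgMl_tmp.
    have /cvg_normR0 := sf _ Dt Nt => h.
    apply/cvgrPdist_le => e e0; move/cvgrPdist_le : h => /(_ e e0).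
    apply: filterS => m; rewrite sub0r normrN ger0_norm ?normR_ge0//.
    rewrite (normRBC (s m t)); apply: le_trans.
    by rewrite -[f t - s m t](subrKA (s' n t)) -(opprB (s m t)) ler_dist_normR.
  by rewrite mul0r; under eq_fun do rewrite mul0r; exact: cvg_cst.
pose H n t := F t - \1_(~` N) t * l (s' n t).
have HG n t : `|H n t| <= C * G n t.
  rewrite /H /F /G; rewrite indicE; case: (t \in ~` N); last first.
    by rewrite !mul0r subrr normr0 mulr0.
  by rewrite !mul1r -real_functionalB// lC.
(* [G n] lies below the possibly nonmeasurable integrand of the definition, so its integral is
   squeezed to 0. *)
have e0 : (\int[mu]_(t in D) (G n t)%:E)%E @[n --> \oo] --> 0%E.
  apply: squeeze_cvge (cvg_cst _) s'f; apply: nearW => n.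
  rewrite integral_ge0/= => [|t _]; last by rewrite lee_fin.
  apply: ge0_le_integral_nonmeasurable => t _; rewrite lee_fin// /G indicE.
  by case: (_ \in _); rewrite ?mul1r ?mul0r ?normR_ge0.
(* A sequence in the extended reals that converges to 0 is finite from some index on. *)
have iG : \forall n \near \oo, mu.-integrable D (EFin \o G n).
  have /fine_cvgP[h _] : (\int[mu]_(t in D) (G n t)%:E)%E @[n --> \oo] --> (0%R)%:E by [].
  apply: filterS h => n Gn; apply/integrableP; split.
    exact/measurable_EFinP.
  by under eq_integral do rewrite /= ger0_norm//; rewrite ltey_eq Gn.
have iHn n : mu.-integrable D (EFin \o G n) -> mu.-integrable D (EFin \o H n).
  move=> iGn; apply: (le_integrable mD _ _ (integrableZl mD C iGn)).
    apply/measurable_EFinP; apply: measurable_funB => //; apply: measurable_funM.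
      by apply: measurable_indic; exact: mNC.
    exact: simple_comp_measurable.
  by move=> t Dt; rewrite /= lee_fin (le_trans (HG _ _))// ler_norm.
have iH n : mu.-integrable D (EFin \o G n) -> ae_integral D F
    (\int[mu]_(t in D) H n t + l (simple_integral D (s' n))).
  move=> iGn.
  have := ae_integral_comb mD 1 1 (ae_integral_integrable (iHn _ iGn))
    (simple_integral_functional lr (ss' n)).
  rewrite !mul1r; apply: ae_integral_ae_eq; exists N; split => // t /= h.
  apply: contrapT => Nt; apply: h => Dt.
  by rewrite /H indicE mem_set// !mul1r subrK.
(* A single integrable [G n] suffices: [F] is almost everywhere [H n] plus a simple function. *)
have [J FJ] : exists J, ae_integral D F J.
  by have [M _ /(_ M (leqnn M)) iGM] := iG; eexists; exact: iH iGM.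
suff -> : l I = J.
  apply: ae_integral_ae_eq FJ; exists N; split => // t /= h.
  apply: contrapT => Nt; apply: h => Dt.
  by rewrite /F indicE mem_set// mul1r.
have lI : l (simple_integral D (s' n)) @[n --> \oo] --> l I.
  exact: real_functional_cvg.
have : l (simple_integral D (s' n)) @[n --> \oo] --> J.
  apply/cvgrPdist_le => e e0'.
  have /fine_cvg /cvgrPdist_le :
    (\int[mu]_(t in D) (G n t)%:E)%E @[n --> \oo] --> (0%R)%:E by [].
  have e1 : 0 < e / (C + 1) by rewrite divr_gt0// ltr_wpDl.
  move=> /(_ _ e1) h; near=> n.
  have iGn : mu.-integrable D (EFin \o G n) by near: n; exact: iG.
  rewrite (ae_integral_uniq mD FJ (iH _ iGn)) addrK.
  have : `|0 - fine (\int[mu]_(t in D) (G n t)%:E)%E| <= e / (C + 1) by near: n.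
  rewrite sub0r normrN => /(le_trans (ler_norm _)).
  rewrite ler_pdivlMr ?ltr_wpDl// => Ge.
  apply: (le_trans (le_normr_Rintegral mD (iHn _ iGn))).
  apply: (@le_trans _ _ (\int[mu]_(t in D) (C * G n t))).
    apply: le_Rintegral => //.
      exact: (integrable_norm (iHn _ iGn)).
    exact: (integrableZl mD C iGn).
  rewrite RintegralZl//.
  have G'0 : 0 <= \int[mu]_(t in D) G n t by apply: Rintegral_ge0.
  by apply: le_trans Ge; rewrite mulrC ler_wpM2l// lerDl.
by rewrite -(cvg_lim (@Rhausdorff R) lI) => /(cvg_lim (@Rhausdorff R)).
Unshelve. all: by end_near. Qed.

End BochnerFunctional.

(** * Bochner integrals of continuous functions *)

Section ContinuousBochner.
Variables (R : realType) (tau : R).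
Hypothesis tau_gt0 : 0 < tau.
Local Notation mu := (@lebesgue_measure R).
Local Notation D := (`]0, tau[%classic : set R).

Lemma measurable_itv0 : measurable (D : set (measurableTypeR R)).
Proof. exact: measurable_itv. Qed.

Lemma itv0_fin : (mu D < +oo)%E.
Proof. by rewrite lebesgue_measure_itv /= lte_fin tau_gt0 ltry. Qed.

(** For [t >= 0], the left end of the cell of length [1 / (n + 1)] that contains [t]. *)
Definition grid_pt (n : nat) (t : R) : R := (Num.truncn (t * n.+1%:R))%:R / n.+1%:R.

Lemma grid_ptP n t : 0 <= t -> grid_pt n t <= t < grid_pt n t + n.+1%:R^-1.
Proof.
move=> t0; have n0 : 0 < n.+1%:R :> R by rewrite ltr0n.
have /truncn_itv/andP[h1 h2] : 0 <= t * n.+1%:R by rewrite mulr_ge0.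
rewrite /grid_pt ler_pdivrMr// h1 /= -{2}[_^-1]mul1r -mulrDl ltr_pdivlMr//.
by rewrite natr1.
Qed.

Lemma grid_pt_cvg t : 0 <= t -> grid_pt n t @[n --> \oo] --> t.
Proof.
move=> t0; apply/cvgrPdist_lt => e e0.
have /cvgrPdist_lt /(_ _ e0) := @cvg_harmonic R.
apply: filterS => n; rewrite sub0r normrN ger0_norm /= ?invr_ge0// => ne.
have /andP[h1 h2] := grid_ptP n t0.
rewrite ger0_norm ?subr_ge0// ltrBlDl; apply: (lt_trans h2).
by rewrite ltrD2l.
Qed.

Section Target.
Variable X : normedModType R[i].
Implicit Types F : R -> X.

(** Vanishing off the bounded interval keeps the range finite. *)
Definition step F n t : X := if t \in D then F (grid_pt n t) else 0.

Lemma step_eq F n t : D t -> step F n t = F (grid_pt n t).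
Proof. by move=> Dt; rewrite /step mem_set. Qed.

Lemma D_ge0 t : D t -> 0 <= t.
Proof. by rewrite /= in_itv /= => /andP[/ltW]. Qed.

Definition cell n k : set R := D `&` [set t | Num.truncn (t * n.+1%:R) = k].

Lemma measurable_cell n k : measurable (cell n k).
Proof.
rewrite (_ : cell n k = D `&` `[k%:R / n.+1%:R, k.+1%:R / n.+1%:R[%classic).
  by apply: measurableI; exact: measurable_itv.
have n0 : 0 < n.+1%:R :> R by rewrite ltr0n.
apply/seteqP; split=> t /= [Dt]; have t0 : 0 <= t * n.+1%:R.
- by rewrite mulr_ge0// D_ge0.
- move=> /eqP; rewrite truncn_eq// => /andP[h1 h2]; split => //.
  by rewrite in_itv /= ler_pdivrMr// h1 ltr_pdivlMr.
- by rewrite mulr_ge0// D_ge0.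
- rewrite in_itv /= ler_pdivrMr// ltr_pdivlMr// => h; split => //.
  by apply/eqP; rewrite truncn_eq.
Qed.

Lemma bigcup_cell n : \bigcup_k cell n k = D.
Proof.
apply/seteqP; split=> t /=; first by move=> [k _ []].
by move=> Dt; exists (Num.truncn (t * n.+1%:R)).
Qed.

Lemma simple_step F n : simple_fun (step F n).
Proof.
have n0 : 0 < n.+1%:R :> R by rewrite ltr0n.
split.
  pose K := (Num.truncn (tau * n.+1%:R)).+1.
  apply: (@sub_finite_set _ _
    ([set 0] `|` [set F (k%:R / n.+1%:R) | k in `I_K])).
    move=> _ [t _ <-]; rewrite /step; case: ifPn => [/set_mem Dt|_]; last by left.
    right; exists (Num.truncn (t * n.+1%:R)) => //=; rewrite ltnS.
    apply: le_truncn; rewrite ler_wpM2r//.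
    by move: Dt; rewrite /= in_itv /= => /andP[_ /ltW].
  by rewrite finite_setU; split => //; apply: finite_image.
move=> x.
rewrite (_ : _ @^-1` _ = \bigcup_(k in [set k | F (k%:R / n.+1%:R) = x]) cell n k
   `|` (if x == 0 then ~` D else set0)).
  apply: measurableU; last by case: ifP => // _; apply: measurableC; exact: measurable_itv.
  by apply: bigcup_measurable => k _; exact: measurable_cell.
apply/seteqP; split=> t /=; rewrite /step.
  case: ifPn => [/set_mem Dt <-|]; first by left; exists (Num.truncn (t * n.+1%:R)).
  by rewrite notin_setE => Dt <-; right; rewrite eqxx.
move=> [[k /= Fk [Dt tk]]|]; first by rewrite mem_set// /grid_pt tk.
by case: eqP => // -> Dt; rewrite memNset.
Qed.

Lemma step_cvg F t : continuous F -> D t -> step F n t @[n --> \oo] --> F t.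
Proof.
move=> cF Dt; rewrite (_ : (fun n => _) = F \o (grid_pt ^~ t)); last first.
  by apply/funext => n; rewrite step_eq.
apply: (@cvg_comp _ _ _ (grid_pt ^~ t) F); last exact: cF.
by apply: grid_pt_cvg; exact: D_ge0.
Qed.

Lemma continuous_strongly_measurable F : continuous F -> strongly_measurable D F.
Proof.
move=> cF; exists (step F); split; first exact: simple_step.
by apply: aeW => t; exact: step_cvg.
Qed.

Lemma normR_continuous F : continuous F -> continuous (fun t => normR (F t)).
Proof.
move=> cF t; apply/cvgrPdist_lt => e e0.
have /cvg_normR_lt /(_ _ e0) := cF t.
by apply: filterS => s; apply: le_lt_trans; exact: ler_dist_normR.
Qed.

Lemma normR_bounded F : continuous F ->
  exists M : R, forall t, t \in `[0, tau] -> normR (F t) <= M.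
Proof.
move=> cF; have [|c _ cM] := @EVT_max R (fun t => normR (F t)) 0 tau (ltW tau_gt0).
  by apply: continuous_subspaceT => t; exact: normR_continuous.
by exists (normR (F c)).
Qed.

Lemma continuous_L2 F : continuous F -> L2 tau F.
Proof.
move=> cF; split; first exact: continuous_strongly_measurable.
have [M FM] := normR_bounded cF.
apply: (@le_lt_trans _ _ (\int[mu]_(t in D) (M ^+ 2)%:E)%E).
  apply: ge0_le_integral_nonmeasurable => t Dt; rewrite lee_fin ?exprn_ge0 ?normR_ge0//.
  have tM : normR (F t) <= M.
    by apply: FM; move: Dt; rewrite /= !in_itv /= => /andP[/ltW -> /ltW ->].
  by rewrite ler_pXn2r ?nnegrE ?normR_ge0// (le_trans _ tM) ?normR_ge0.
rewrite integral_cst; last exact: measurable_itv0.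
rewrite lte_mul_pinfty ?lee_fin ?sqr_ge0// itv0_fin//.
Qed.

(** On each cell the step function is constant, so the difference is continuous there. *)
Lemma step_measurable F n : continuous F ->
  measurable_fun (T := measurableTypeR R) D (fun t => normR (F t - step F n t)).
Proof.
move=> cF; rewrite -(bigcup_cell n).
apply/measurable_fun_bigcup => k; first exact: measurable_cell.
apply: (@eq_measurable_fun _ _ (measurableTypeR R) R _
   (fun t => normR (F t - F (k%:R / n.+1%:R)))).
  by move=> t /set_mem [Dt /= tk]; rewrite step_eq// /grid_pt tk.
apply: measurable_funTS; apply: continuous_measurable_fun.
apply: normR_continuous => t; apply: cvgB; [exact: cF|exact: cvg_cst].
Qed.

Lemma step_integral_cvg F : continuous F ->
  (\int[mu]_(t in D) (normR (F t - step F n t))%:E)%E @[n --> \oo] --> 0%E.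
Proof.
move=> cF; have [M FM] := normR_bounded cF.
have M0 : 0 <= M.
  by apply: (le_trans (normR_ge0 (F 0)) (FM 0 _)); rewrite in_itv /= lexx ltW.
have [] := @dominated_convergence _ _ _ mu D measurable_itv0
  (fun n t => (normR (F t - step F n t))%:E) (cst 0%E) (cst (2 * M)%:E).
- by move=> n; apply/measurable_EFinP; exact: step_measurable.
- exact: measurable_cst.
- apply: aeW => t Dt; apply: cvg_EFin; first exact: nearW.
  have /cvg_normR0 := step_cvg cF Dt.
  by apply: cvg_trans; apply: near_eq_cvg; apply: nearW => n /=; exact: normRBC.
- apply/integrableP; split; first exact: measurable_cst.
  rewrite /= integral_cst; last exact: measurable_itv0.
  by rewrite lte_mul_pinfty ?lee_fin ?normr_ge0// itv0_fin.
- apply: aeW => t n Dt; rewrite /= lee_fin ger0_norm ?normR_ge0//.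
  have /andP[h1 h2] := grid_ptP n (D_ge0 Dt).
  have g0 : 0 <= grid_pt n t by rewrite divr_ge0.
  have tM : normR (F t) <= M.
    by apply: FM; move: Dt; rewrite /= !in_itv /= => /andP[/ltW -> /ltW ->].
  have gM : normR (F (grid_pt n t)) <= M.
    apply: FM; rewrite in_itv /= g0 (le_trans h1)//.
    by move: Dt; rewrite /= in_itv /= => /andP[_ /ltW].
  rewrite step_eq// (le_trans (ler_normRD _ _))// normRN; lra.
by move=> _ _; rewrite integral0.
Qed.

End Target.

(** * Integrals of images under bounded linear injections *)

Section Images.
Variables (X Y : normedModType R[i]) (T : X -> Y).
Hypotheses (Tlin : linear T) (Tinj : injective T).
Hypothesis (Tbd : exists C : R, forall x, normR (T x) <= C * normR x).

Lemma linear_fun0 : T 0 = 0.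
Proof.
have := Tlin (-1) 0 0; rewrite scaler0 addr0 scaleN1r addNr.
by [].
Qed.

Lemma linear_funZ (l : R[i]) x : T (l *: x) = l *: T x.
Proof. by rewrite -[l *: x]addr0 Tlin linear_fun0 addr0. Qed.

Lemma linear_funD x y : T (x + y) = T x + T y.
Proof. by rewrite -[x]scale1r Tlin !scale1r. Qed.

Lemma linear_funB x y : T (x - y) = T x - T y.
Proof. by rewrite linear_funD -scaleN1r linear_funZ scaleN1r. Qed.

Lemma linear_fun_sum (I : Type) (r : seq I) (x : I -> X) :
  T (\sum_(i <- r) x i) = \sum_(i <- r) T (x i).
Proof.
elim: r => [|i r IH]; first by rewrite !big_nil linear_fun0.
by rewrite !big_cons linear_funD IH.
Qed.

Lemma bounded_cvg {U} {F : set_system U} {FF : Filter F} (f : U -> X) x :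
  f @ F --> x -> T (f t) @[t --> F] --> T x.
Proof.
have [C TC] := Tbd; move=> fx; apply/cvg_normR_lt => e e0.
have e1 : 0 < e / (`|C| + 1) by rewrite divr_gt0// ltr_wpDl.
have /cvg_normR_lt /(_ _ e1) := fx; apply: filterS => t h.
rewrite -linear_funB; apply: (le_lt_trans (TC _)).
move: h; rewrite ltr_pdivlMr ?ltr_wpDl// => h.
have := normR_ge0 (x - f t); have := ler_norm C; nra.
Qed.

(** Injectivity makes the level sets of [T] after [s] those of [s], so the two sums match term by
    term. *)
Lemma simple_integral_image (s : R -> X) : simple_fun s ->
  simple_integral D (fun t => T (s t)) = T (simple_integral D s).
Proof.
move=> [fs ms]; rewrite /simple_integral.
rewrite (@reindex_fsbig _ _ _ _ _ T (range s)); last first.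
  split; first by move=> _ [t _ <-]; exists t.
    by move=> x y _ _ /Tinj.
  by move=> _ [t _ <-]; exists (s t) => //; exists t.
rewrite !fsbig_finite// linear_fun_sum; apply: eq_bigr => x _.
rewrite linear_funZ; congr ((fine (mu (_ `&` _)))%:C *: _).
by apply/seteqP; split=> t /=; [move=> /Tinj|move=> ->].
Qed.

(** The limit found in [X] is pushed forward by [T]; integrals with values in [V'] are obtained in
    this way from integrals in [l2]. *)
Lemma bochner_image (F : R -> X) (I : X) : continuous F ->
  simple_integral D (step F n) @[n --> \oo] --> I ->
  has_bochner_integral D (fun t => T (F t)) (T I).
Proof.
move=> cF FI; have cTF : continuous (fun t => T (F t)) by move=> t; apply: bounded_cvg; exact: cF.
split; first exact: continuous_strongly_measurable.
exists (step (fun t => T (F t))); split.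
- exact: simple_step.
- exact: step_integral_cvg.
- rewrite (_ : (fun n => _) = (fun n => T (simple_integral D (step F n)))).
    exact: bounded_cvg.
  apply/funext => n; rewrite -simple_integral_image; last exact: simple_step.
  congr simple_integral; apply/funext => t.
  by rewrite /step; case: ifP => //; rewrite linear_fun0.
Qed.

End Images.

(** * Convergence of step integrals in [l2] *)

Section L2Valued.
Implicit Types (F : R -> l2 R).

Lemma Re_l2inner_le (x z : l2 R) :
  `|complex.Re (l2inner x z)| <= normR z * normR x.
Proof.
have := normR_inner x z; rewrite mulrC; apply: le_trans.
have -> : inner x z = l2inner x z by [].
by rewrite /normR; case: (l2inner x z) => p q; rewrite normc_def /=
  -[leLHS]sqrtr_sqr ler_wsqrtr// lerDl sqr_ge0.
Qed.

Lemma real_functional_inner (z : l2 R) :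
  real_functional (fun x : l2 R => complex.Re (l2inner x z)).
Proof.
split.
- move=> x y; have := l2innerPl z 1 x y; rewrite scale1r mul1r => ->.
  by case: (l2inner x z) => ? ?; case: (l2inner y z).
- by move=> r x; rewrite l2innerZl; case: (l2inner x z) => ? ? /=; rewrite mul0r subr0.
- exists (normR z); first exact: normR_ge0.
  by move=> x; exact: Re_l2inner_le.
Qed.

Lemma Re_l2innerB (x y z : l2 R) : complex.Re (l2inner x z) - complex.Re (l2inner y z) =
  complex.Re (l2inner (x - y) z).
Proof. exact/esym/(real_functionalB _ _ (real_functional_inner z)). Qed.

Lemma continuous_bochner_l2 F : continuous F -> exists I : l2 R,
  simple_integral D (step F n) @[n --> \oo] --> I.
Proof.
move=> cF; pose I n := simple_integral D (step F n).
pose e n := fine (\int[mu]_(t in D) (normR (F t - step F n t))%:E)%E.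
have [M FM] := normR_bounded cF.
have M0 : 0 <= M.
  by apply: (le_trans (normR_ge0 (F 0)) (FM 0 _)); rewrite in_itv /= lexx ltW.
have he n : ae_integral D (fun t => normR (F t - step F n t)) (e n).
  apply: (ae_integral_bounded measurable_itv0 itv0_fin (C := 2 * M)).
    exact: step_measurable.
  move=> t Dt; rewrite ger0_norm ?normR_ge0//.
  have /andP[h1 h2] := grid_ptP n (D_ge0 Dt).
  have g0 : 0 <= grid_pt n t by rewrite divr_ge0.
  have tM : normR (F t) <= M.
    by apply: FM; move: Dt; rewrite /= !in_itv /= => /andP[/ltW -> /ltW ->].
  have gM : normR (F (grid_pt n t)) <= M.
    apply: FM; rewrite in_itv /= g0 (le_trans h1)//.
    by move: Dt; rewrite /= in_itv /= => /andP[_ /ltW].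
  rewrite step_eq// (le_trans (ler_normRD _ _))// normRN; lra.
have e0 : e @ \oo --> (0 : R) by apply: fine_cvg; exact: step_integral_cvg.
(* Pairing the difference [z] with itself writes [|z|^2] as a scalar integral, bounded by [|z|]
   times the sum of the two errors; then divide by [|z|]. *)
have Inm n m : normR (I n - I m) <= e n + e m.
  set z := I n - I m.
  have lz := real_functional_inner z.
  have h1 := simple_integral_functional measurable_itv0 itv0_fin lz (simple_step F n).
  have h2 := simple_integral_functional measurable_itv0 itv0_fin lz (simple_step F m).
  have h := ae_integral_comb measurable_itv0 1 (-1) h1 h2.
  have h' := ae_integral_comb measurable_itv0 (normR z) (normR z) (he n) (he m).
  have := ae_integral_le measurable_itv0 _ h h'.
  rewrite !mul1r !mulN1r Re_l2innerB -/(I n) -/(I m) -/z l2inner_diag.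
  rewrite [complex.Re (_%:C)]/= -normR_l2_sqr -mulrDr => H.
  have [->|z0] := eqVneq (normR z) 0.
    by rewrite addr_ge0// fine_ge0// integral_ge0// => t _; rewrite lee_fin normR_ge0.
  have zp : 0 < normR z by rewrite lt_def z0 normR_ge0.
  rewrite -(ler_pM2l zp) -expr2; apply: H; apply: aeW => t Dt.
  rewrite mul1r mulN1r Re_l2innerB -mulrDr.
  apply: (le_trans (ler_norm _)); apply: (le_trans (Re_l2inner_le _ _)).
  rewrite ler_wpM2l ?normR_ge0// (normRBC (F t)).
  exact: ler_normRB_add.
have : cvg (I @ \oo).
  apply/cauchy_cvgP/cauchy_exP => eps eps0.
  have [ep ep0] := gt0_complexE eps0; rewrite ep.
  have h : \forall n \near \oo, e n < complex.Re eps / 2.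
    have /cvgrPdist_lt := e0 => /(_ (complex.Re eps / 2)).
    rewrite divr_gt0// => /(_ erefl).
    by apply: filterS => n; rewrite sub0r normrN; apply: le_lt_trans; exact: ler_norm.
  move: h => [N _ h]; exists (I N).
  have key n : (N <= n)%N -> normR (I N - I n) < complex.Re eps.
    move=> Nn; apply: (le_lt_trans (Inm _ _)).
    have hN : e N < complex.Re eps / 2 by apply: h; exact: leqnn.
    have hn : e n < complex.Re eps / 2 by exact: h.
    move: (e N) (e n) (complex.Re eps) hN hn; clear; move=> a b c; lra.
  exists N => // n Nn.
  exact/(@ball_normR R (l2 R))/key.
by move=> /cvg_ex[L IL]; exists L.
Qed.

End L2Valued.

End ContinuousBochner.

(** * Smooth functions and test functions *)

Section Smooth.
Variable R : realType.
Implicit Types (f g : R -> R) (P : {poly R}).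

Definition smooth f := forall n t, derivable (derive1n n f) t 1.

Lemma is_derive1_derive1 f (g : R -> R) : (forall t : R, is_derive t 1 f (g t)) -> derive1 f = g.
Proof. by move=> fg; apply/funext => t; rewrite derive1E; apply: derive_val. Qed.

Lemma is_derive_derivable f (g : R -> R) : (forall t : R, is_derive t 1 f (g t)) ->
  forall t, derivable f t 1.
Proof. by move=> fg t; have [] := fg t. Qed.

Lemma derivable_is_derive f : (forall t, derivable f t 1) ->
  forall t : R, is_derive t 1 f (derive1 f t).
Proof. by move=> df t; rewrite derive1E; exact/derivableP. Qed.

(** A class of functions stable under differentiation consists of smooth functions; formulas for
    higher derivatives are thereby avoided. *)
Lemma smooth_coind (S : (R -> R) -> Prop) :
  (forall f, S f -> exists2 g, S g & forall t : R, is_derive t 1 f (g t)) ->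
  forall f, S f -> smooth f.
Proof.
move=> SS f Sf n; suff /SS[g _ fg] : S (derive1n n f) by exact: is_derive_derivable fg.
elim: n => [//|n /SS[g Sg fg]].
by rewrite derive1nS (is_derive1_derive1 fg).
Qed.

Lemma smooth_derivable f t : smooth f -> derivable f t 1.
Proof. by move=> /(_ 0%N). Qed.

Lemma smooth_derive1 f : smooth f -> smooth (derive1 f).
Proof. by move=> sf n t; have := sf n.+1 t; rewrite derive1Sn. Qed.

Lemma smooth_continuous f : smooth f -> continuous f.
Proof.
by move=> sf t; apply/differentiable_continuous/derivable1_diffP/smooth_derivable.
Qed.

(* Sums of products of smooth functions are stable under differentiation. *)
Inductive smooth_product : (R -> R) -> Prop :=
| smooth_prod f g : smooth f -> smooth g -> smooth_product (f * g)
| smooth_sum f g : smooth_product f -> smooth_product g -> smooth_product (f + g).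

Lemma smoothM f g : smooth f -> smooth g -> smooth (fun t => f t * g t).
Proof.
move=> sf sg; rewrite -[X in smooth X]/(f * g).
apply: (smooth_coind (S := smooth_product)) (smooth_prod sf sg) => h {f g sf sg}.
elim=> [f g sf sg|f g _ [f' Sf' ff'] _ [g' Sg' gg']].
- exists (f * derive1 g + derive1 f * g).
    exact: (smooth_sum (smooth_prod sf (smooth_derive1 sg))
      (smooth_prod (smooth_derive1 sf) sg)).
  move=> t.
  have H := @is_deriveM R R f g t 1 (derive1 f t) (derive1 g t)
    (derivable_is_derive (fun t => smooth_derivable sf) t)
    (derivable_is_derive (fun t => smooth_derivable sg) t).
  apply: (is_derive_eq H); rewrite /GRing.scale /= !fctE; congr (_ + _); exact: mulrC.
- by exists (f' + g') => [|t]; [exact: smooth_sum|exact: is_deriveD].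
Qed.

Lemma smoothD f g : smooth f -> smooth g -> smooth (fun t => f t + g t).
Proof.
move=> sf sg; pose S h := exists p q, [/\ smooth p, smooth q & h = p + q].
apply: (smooth_coind (S := S)); last by exists f, g.
move=> _ [p [q [sp sq ->]]]; exists (derive1 p + derive1 q).
  exists (derive1 p), (derive1 q).
  by split; [exact: smooth_derive1|exact: smooth_derive1|].
move=> t; apply: is_deriveD; apply: derivable_is_derive => s; exact: smooth_derivable.
Qed.

Lemma smooth_trig (a b w : R) : smooth (fun t => a * cos (w * t) + b * sin (w * t)).
Proof.
pose S h := exists a b : R, h = (fun t => a * cos (w * t) + b * sin (w * t)).
apply: (smooth_coind (S := S)); last by exists a, b.
move=> _ [p [q ->]]; exists (fun t => q * w * cos (w * t) + (- (p * w)) * sin (w * t)).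
  by exists (q * w), (- (p * w)).
move=> t; apply: is_derive_eq.
rewrite /GRing.scale /=; ring.
Qed.

Lemma smooth_cst (c : R) : smooth (fun=> c).
Proof.
pose S h := exists c : R, h = (fun _ : R => c).
apply: (smooth_coind (S := S)); last by exists c.
by move=> _ [p ->]; exists (fun=> 0); [exists 0|move=> t; exact: is_derive_cst].
Qed.

(** Each [s^i exp(- s)] is at most [i!], because the exponential dominates its Taylor terms on
    [s >= 0]. *)
Lemma poly_expR_bounded P : exists2 C : R, 0 <= C &
  forall s, 0 <= s -> `|P.[s]| * expR (- s) <= C.
Proof.
have xn n s : 0 <= s -> s ^+ n * expR (- s) <= n`!%:R.
  move=> s0; rewrite expRN ler_pdivrMr ?expR_gt0//; case: n => [|n].
    by rewrite expr0 mul1r (le_trans _ (expR_ge1Dx s))// lerDl.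
  rewrite mulrC -ler_pdivrMr ?ltr0n ?fact_gt0//.
  by apply: le_trans (expR_ge1Dxn n s0); rewrite lerDr.
exists (\sum_(i < size P) `|P`_i| * i`!%:R) => [|s s0].
  by apply: sumr_ge0 => i _; rewrite mulr_ge0.
rewrite horner_coef.
apply: (@le_trans _ _ ((\sum_(i < size P) `|P`_i| * s ^+ i) * expR (- s))).
  rewrite ler_wpM2r ?expR_ge0//; apply: (le_trans (ler_norm_sum _ _ _)).
  by apply: ler_sum => i _; rewrite normrM (ger0_norm (exprn_ge0 _ s0)).
rewrite mulr_suml; apply: ler_sum => i _; rewrite -mulrA ler_wpM2l//.
exact: xn.
Qed.

(* The derivatives of [exp(-1/t)], extended by [0] to [t <= 0], all belong to this
   family. *)
Definition flat P t : R := if 0 < t then P.[t^-1] * expR (- t^-1) else 0.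

Lemma flat_le0 P t : t <= 0 -> flat P t = 0.
Proof. by rewrite /flat leNgt => /negbTE ->. Qed.

(** For [t > 0] the chain rule brings out [t^-2], the value of ['X^2] at [t^-1]. Only the point 0
    calls for an estimate. *)
Lemma is_derive_flat P (t : R) :
  is_derive t 1 (flat P) (flat ('X^2 * (P - P^`())) t).
Proof.
have [t0|t0|<-] := ltgtP 0 t.
- have h : is_derive t 1 (fun s : R => P.[s^-1] * expR (- s^-1))
      (flat ('X^2 * (P - P^`())) t).
    have t1 : t != 0 by rewrite gt_eqF.
    have iv : is_derive t 1 (fun s : R => s^-1) (- t ^- 2).
      apply: (is_derive_eq (is_deriveV (f := id) t1 (is_derive_id t (1 : R)))).
      by rewrite /GRing.scale /= mulr1.
    have hp : is_derive t 1 (horner P \o (fun s : R => s^-1)) (P^`().[t^-1] * - t ^- 2).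
      exact: is_derive1_comp.
    have he : is_derive t 1 (expR \o (fun s : R => - s^-1)) (expR (- t^-1) * t ^- 2).
      by apply: is_derive1_comp; rewrite -[t ^- 2]opprK; exact: is_deriveN.
    apply: (is_derive_eq (is_deriveM hp he)).
    rewrite /flat t0 !hornerE /= /GRing.scale /= exprVn; ring.
  apply: near_eq_is_derive h; near=> s; rewrite /flat ifT//.
  by near: s; exact: lt_nbhsr.
- have -> : flat ('X^2 * (P - P^`())) t = 0 by apply: flat_le0; exact: ltW.
  apply: (near_eq_is_derive (f := cst 0)).
  by near=> s; rewrite flat_le0//=; apply: ltW; near: s; exact: lt_nbhsl.
- rewrite [X in is_derive _ _ _ X]flat_le0//.
  (* The extra factor ['X^2] yields [|flat P h| <= C h^2], so the difference quotient at 0 tends to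
     0. *)
  have [C C0 hC] := poly_expR_bounded ('X^2 * P).
  have bd h : `|flat P h| <= C * h ^+ 2.
    rewrite /flat; case: ifPn => h0; last by rewrite normr0 mulr_ge0 ?sqr_ge0.
    have := hC h^-1; rewrite invr_ge0 (ltW h0) => /(_ erefl).
    rewrite hornerM hornerXn normrM (ger0_norm (x := h^-1 ^+ 2)); last first.
      by rewrite exprn_ge0// invr_ge0 ltW.
    rewrite exprVn -mulrA ler_pdivrMl ?exprn_gt0// [_ * C]mulrC.
    by rewrite normrM (ger0_norm (expR_ge0 _)).
  have cv : h^-1 *: (flat P (h *: (1 : R) + 0) - flat P 0) @[h --> 0^'] --> (0 : R).
    apply/cvgrPdist_le => e e0; near=> h.
    have h0 : h != 0 by near: h; exact: nbhs_dnbhs_neq.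
    rewrite sub0r normrN (flat_le0 _ (lexx 0)) subr0 addr0 [h *: 1]mulr1 normrM normfV.
    rewrite ler_pdivrMl ?normr_gt0//; apply: (le_trans (bd h)).
    rewrite -real_normK ?num_real// expr2 mulrCA ler_wpM2l//.
    have : `|h| <= e / (C + 1).
      by near: h; apply: dnbhs0_le; rewrite divr_gt0// ltr_wpDl.
    rewrite ler_pdivlMr ?ltr_wpDl// => h1.
    by apply: le_trans h1; rewrite mulrC ler_wpM2l// lerDl.
  by apply: DeriveDef; [apply: cvgP cv|exact: cvg_lim cv].
Unshelve. all: by end_near. Qed.

Lemma smooth_flat P (c s : R) : smooth (fun t => flat P (s * t + c)).
Proof.
(* The factor [k] collects the powers of [s] produced by the chain rule. *)
pose S h := exists P k, h = (fun t => k * flat P (s * t + c)).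
apply: (smooth_coind (S := S)); last first.
  by exists P, 1; apply/funext => t; rewrite mul1r.
move=> _ [Q [k ->]]; exists (fun t => (k * s) * flat ('X^2 * (Q - Q^`())) (s * t + c)).
  by exists ('X^2 * (Q - Q^`())), (k * s).
move=> t.
have h1 : is_derive t 1 (fun t : R => s * t + c) s.
  by apply: is_derive_eq; rewrite /GRing.scale /= mulr1 addr0.
have h2 : is_derive t 1 (flat Q \o (fun t : R => s * t + c))
    (flat ('X^2 * (Q - Q^`())) (s * t + c) * s).
  by apply: is_derive1_comp; exact: is_derive_flat.
have H := is_deriveZ k h2.
have E : k *: (flat ('X^2 * (Q - Q^`())) (s * t + c) * s) =
    k * s * flat ('X^2 * (Q - Q^`())) (s * t + c) by rewrite /GRing.scale /=; ring.
by rewrite E in H; exact: H.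
Qed.

End Smooth.

(** * Test functions and integration by parts *)

Section TestFunctions.
Variables (R : realType) (tau : R).
Hypothesis tau_gt0 : 0 < tau.
Local Notation mu := (@lebesgue_measure R).
Local Notation D := (`]0, tau[%classic : set R).
Implicit Types (phi theta f g : R -> R).

Lemma test_smooth phi : test_function tau phi -> smooth phi.
Proof. by case. Qed.

Lemma test_sub_closure phi theta : test_function tau phi -> smooth theta ->
  [set t | theta t != 0] `<=` closure [set t | phi t != 0] -> test_function tau theta.
Proof.
move=> [sphi cphi phiD] sth thphi.
have cl : closure [set t | theta t != 0] `<=` closure [set t | phi t != 0].
  exact: subset_trans (closure_subset thphi) (@closed_closure _ _).
split => //; last exact: subset_trans cl phiD.
exact: (subclosed_compact (@closed_closure _ _) cphi cl).
Qed.

Lemma testM phi theta : test_function tau phi -> smooth theta ->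
  test_function tau (fun t => phi t * theta t).
Proof.
move=> tphi sth; apply: (test_sub_closure tphi); first exact: smoothM (test_smooth tphi) sth.
move=> t /= h; apply: subset_closure => /=.
by apply: contra_neq h => ->; rewrite mul0r.
Qed.

(** Off its closed support [phi] vanishes on a whole neighbourhood, and so does its derivative. *)
Lemma test_derive1 phi : test_function tau phi -> test_function tau (derive1 phi).
Proof.
move=> tphi; apply: (test_sub_closure tphi).
  exact/smooth_derive1/test_smooth.
move=> t /= h; apply: contrapT => nt; move/eqP : h; apply.
have : \forall s \near t, phi s = 0.
  have : nbhs t (~` closure [set t | phi t != 0]).
    by apply: open_nbhs_nbhs; split => //; apply: closed_openC; exact: closed_closure.
  apply: filterS => s ns; apply/eqP/negPn/negP => ps.
  by apply: ns; exact: subset_closure.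
move=> ph; rewrite derive1E (near_eq_derive _ (g := cst 0)).
  by rewrite derive_cst.
exact: ph.
Qed.

Lemma test_outside phi t : test_function tau phi -> ~ D t -> phi t = 0.
Proof.
move=> [_ _ h] nt; apply/eqP/negPn/negP => pt; apply: nt; apply: h.
exact: subset_closure.
Qed.

Lemma test_bounded phi : test_function tau phi -> exists C : R, forall t, `|phi t| <= C.
Proof.
move=> tphi; have [|c _ cM] := @EVT_max R (fun t => `|phi t|) 0 tau (ltW tau_gt0).
  apply: continuous_subspaceT => t; apply: cvg_norm.
  exact: smooth_continuous (test_smooth tphi) t.
exists `|phi c| => t; have [tD|tD] := pselect (D t).
  by apply: cM; move: tD; rewrite /= !in_itv /= => /andP[/ltW -> /ltW ->].
by rewrite (test_outside tphi tD) normr0.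
Qed.

Lemma bump_exists (a b : R) : 0 < a -> a < b -> b < tau ->
  exists phi, [/\ test_function tau phi, forall t, 0 <= phi t,
    forall t, a < t < b -> 0 < phi t & forall t, ~ (a < t < b) -> phi t = 0].
Proof.
(* On []a, b[] this is [exp(- 1 / (t - a)) exp(- 1 / (b - t))]. *)
move=> a0 ab bt; pose phi t : R := flat 1 (1 * t + (- a)) * flat 1 ((-1) * t + b).
have fpos s : 0 < s -> 0 < flat (1 : {poly R}) s.
  by move=> s0; rewrite /flat s0 hornerC mul1r expR_gt0.
have fge0 s : 0 <= flat (1 : {poly R}) s.
  by rewrite /flat; case: ifP => // _; rewrite hornerC mul1r expR_ge0.
have phi0 t : ~ (a < t < b) -> phi t = 0.
  move=> h; rewrite /phi; have [ta|ta] := leP t a.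
    by rewrite flat_le0 ?mul0r//; lra.
  rewrite [X in _ * X]flat_le0 ?mulr0//; have [tb|] := ltP t b; last by lra.
  by exfalso; apply: h; rewrite ta tb.
have sub : closure [set t | phi t != 0] `<=` `[a, b]%classic.
  have h : [set t | phi t != 0] `<=` `[a, b]%classic.
    move=> t /= pt; apply: contrapT => nt; move/eqP : pt; apply.
    apply: phi0 => /andP[h1 h2]; apply: nt.
    by rewrite /= in_itv /= !ltW.
  exact: subset_trans (closure_subset h) (@itv_closed _ _ a b).
exists phi; split => //.
- split.
  + by apply: smoothM; exact: smooth_flat.
  + exact: (subclosed_compact (@closed_closure _ _) (segment_compact (a := a) (b := b)) sub).
  + move=> t /sub; rewrite /= !in_itv /= => /andP[h1 h2].
    by rewrite (lt_le_trans a0 h1) (le_lt_trans h2 bt).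
- by move=> t; rewrite mulr_ge0.
- by move=> t /andP[h1 h2]; rewrite mulr_gt0//; apply: fpos; lra.
Qed.

Lemma integrable_continuous f (A : set R) : measurable (A : set (measurableTypeR R)) ->
  (mu A < +oo)%E -> A `<=` `[0, tau]%classic -> continuous f ->
  mu.-integrable A (EFin \o f).
Proof.
move=> mA Afin A0 cf; have [|c _ cM] := @EVT_max R (fun t => `|f t|) 0 tau (ltW tau_gt0).
  by apply: continuous_subspaceT => t; apply: cvg_norm; exact: cf.
apply: measurable_bounded_integrable => //.
  by apply: measurable_funTS; exact: continuous_measurable_fun.
exists `|f c|; split; first exact: num_real.
by move=> x Cx t At; apply: le_trans (ltW Cx); apply: cM; exact: (A0 _ At).
Qed.

Lemma ae_integral_continuous f : continuous f ->
  ae_integral D f (\int[mu]_(t in D) f t).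
Proof.
move=> cf; apply: ae_integral_integrable.
apply: integrable_continuous cf; [exact: measurable_itv0|exact: itv0_fin|].
by move=> t /=; rewrite !in_itv /= => /andP[/ltW -> /ltW ->].
Qed.

Lemma integration_by_parts_test phi f g : test_function tau phi ->
  (forall t : R, is_derive t 1 f (g t)) -> continuous g ->
  ae_integral D (fun t => derive1 phi t * f t + phi t * g t) 0.
Proof.
move=> tphi fg cg; have sphi := test_smooth tphi.
have cphi := smooth_continuous sphi.
have cphi' := smooth_continuous (smooth_derive1 sphi).
have cf : continuous f.
  by move=> t; apply/differentiable_continuous/derivable1_diffP; have [] := fg t.
pose h t := derive1 phi t * f t + phi t * g t.
have ch : continuous h.
  by move=> t; apply: cvgD; apply: cvgM; [exact: cphi'|exact: cf|exact: cphi|exact: cg].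
have := ae_integral_continuous ch; rewrite -/h.
suff -> : \int[mu]_(t in D) h t = 0 by [].
pose F t := phi t * f t.
have dF (t : R) : is_derive t 1 F (h t).
  have H := is_deriveM (derivable_is_derive (fun t => smooth_derivable sphi) t) (fg t).
  have E : phi t *: g t + f t *: derive1 phi t = h t.
    by rewrite /h addrC; congr (_ + _); rewrite /GRing.scale /= mulrC.
  by rewrite E in H; exact: H.
have cF : continuous F by move=> t; apply: cvgM; [exact: cphi|exact: cf].
rewrite Rintegral_itv_obnd_cbnd; last first.
  apply: integrable_continuous ch; [exact: measurable_itv0|exact: itv0_fin|].
  by move=> t /=; rewrite !in_itv /= => /andP[/ltW -> /ltW ->].
rewrite Rintegral_itv_bndo_bndc; last first.
  apply: integrable_continuous ch; first exact: measurable_itv.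
    by rewrite lebesgue_measure_itv /= lte_fin tau_gt0 ltry.
  by move=> t /=; rewrite !in_itv /= => /andP[-> /ltW ->].
rewrite /Rintegral (continuous_FTC2 (F := F) tau_gt0)//.
- have p1 : phi tau = 0 by apply: (test_outside tphi); rewrite /= in_itv /= ltxx andbF.
  have p0 : phi 0 = 0 by apply: (test_outside tphi); rewrite /= in_itv /= ltxx.
  by rewrite /F p1 p0 !mul0r /= subrr.
- exact: continuous_subspaceT.
- split.
  + by move=> t _; have [] := dF t.
  + by apply: cvg_at_right_filter; exact: cF.
  + by apply: cvg_at_left_filter; exact: cF.
- by move=> t _; rewrite (is_derive1_derive1 dF).
Qed.

End TestFunctions.

(** * Weak derivatives *)

Section WeakDerivative.
Variables (R : realType) (tau : R).
Hypothesis tau_gt0 : 0 < tau.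
Local Notation mu := (@lebesgue_measure R).
Local Notation D := (`]0, tau[%classic : set R).

Lemma real_functional_Re n : real_functional (fun x : l2 R => complex.Re (x n)).
Proof.
split.
- by move=> x y; rewrite l2D; case: (x n) => ? ?; case: (y n).
- by move=> r x; rewrite l2Z; case: (x n) => ? ? /=; rewrite mul0r subr0.
- by exists 1 => // x; rewrite mul1r Re_le_normR.
Qed.

Lemma real_functional_Im n : real_functional (fun x : l2 R => complex.Im (x n)).
Proof.
split.
- by move=> x y; rewrite l2D; case: (x n) => ? ?; case: (y n).
- by move=> r x; rewrite l2Z; case: (x n) => ? ? /=; rewrite mul0r addr0.
- by exists 1 => // x; rewrite mul1r Im_le_normR.
Qed.

Lemma continuous_scale (X : normedModType R[i]) (phi : R -> R) (f : R -> X) :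
  continuous phi -> continuous f -> continuous (fun t => (phi t)%:C *: f t).
Proof.
move=> cphi cf t; apply/cvg_normR0.
have h0 : (fun s => `|phi s - phi t|) @ t --> `|phi t - phi t|.
  by apply: cvg_norm; apply: cvgB; [exact: cphi|exact: cvg_cst].
rewrite subrr normr0 in h0.
have h : (fun s => `|phi s| * normR (f s - f t) + `|phi s - phi t| * normR (f t)) @ t
    --> (`|phi t| * 0 + 0 * normR (f t) : R).
  apply: cvgD; apply: cvgM.
  - by apply: cvg_norm; exact: cphi.
  - exact: ((cvg_normR0 _ _).1 (cf t)).
  - exact: h0.
  - exact: cvg_cst.
rewrite mulr0 mul0r addr0 in h.
apply: squeeze_cvgr (cvg_cst _) h; apply: nearW => s; rewrite normR_ge0 /=.
rewrite -!normRZr; apply: le_trans (ler_normRD _ _).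
by rewrite rmorphB /= scalerBr scalerBl addrA subrK.
Qed.

Lemma bochner_continuous_l2 (F : R -> l2 R) : continuous F ->
  exists2 I : l2 R, simple_integral D (step tau F n) @[n --> \oo] --> I &
    has_bochner_integral D F I.
Proof.
move=> cF; have [I FI] := continuous_bochner_l2 tau_gt0 cF; exists I => //.
have := @bochner_image R tau tau_gt0 (l2 R) (l2 R) id _ _ _ F I cF FI.
by apply => //; exists 1 => x; rewrite mul1r.
Qed.

(** Both integrals exist in [l2], where vectors are determined by their coordinates. Scalar
    integration by parts in each coordinate gives [I2 = - I1], which [T] carries over to [Y]. *)
Lemma weak_derivative_image (Y : normedModType R[i]) (T : l2 R -> Y) (f g : R -> l2 R) :
  linear T -> injective T -> (exists C : R, forall x, normR (T x) <= C * normR x) ->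
  continuous f -> continuous g ->
  (forall n (t : R), is_derive t 1 (fun s => complex.Re (f s n)) (complex.Re (g t n))) ->
  (forall n (t : R), is_derive t 1 (fun s => complex.Im (f s n)) (complex.Im (g t n))) ->
  weak_derivative tau (fun t => T (f t)) (fun t => T (g t)).
Proof.
move=> Tlin Tinj Tbd cf cg dRe dIm phi tphi.
have sphi := test_smooth tphi.
have c1 : continuous (fun t => (derive1 phi t)%:C *: f t).
  by apply: continuous_scale => //; exact/smooth_continuous/smooth_derive1.
have c2 : continuous (fun t => (phi t)%:C *: g t).
  by apply: continuous_scale => //; exact/smooth_continuous.
have [I1 s1 b1] := bochner_continuous_l2 c1.
have [I2 s2 b2] := bochner_continuous_l2 c2.
have key (l : l2 R -> R) : real_functional l -> continuous (fun t => l (g t)) ->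
    (forall t : R, is_derive t 1 (fun s => l (f s)) (l (g t))) -> l I1 + l I2 = 0.
  move=> lr clg dl.
  have h1 := bochner_functional (measurable_itv0 tau) (itv0_fin tau_gt0) lr b1.
  have h2 := bochner_functional (measurable_itv0 tau) (itv0_fin tau_gt0) lr b2.
  have := ae_integral_comb (measurable_itv0 tau) 1 1 h1 h2.
  rewrite !mul1r => h3.
  apply: (ae_integral_uniq (measurable_itv0 tau) h3).
  apply: ae_integral_eq (integration_by_parts_test tau_gt0 tphi dl clg).
  by move=> t _; have [_ lZ _] := lr; rewrite !mul1r !lZ.
have I12 : I2 = - I1.
  apply: l2_ext => n; rewrite l2N.
  have kr := key _ (real_functional_Re n) _ (dRe n).
  have ki := key _ (real_functional_Im n) _ (dIm n).
  have {}kr : complex.Re (I1 n) + complex.Re (I2 n) = 0.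
    by apply: kr => t; apply: real_functional_cvg (real_functional_Re n) _; exact: cg.
  have {}ki : complex.Im (I1 n) + complex.Im (I2 n) = 0.
    by apply: ki => t; apply: real_functional_cvg (real_functional_Im n) _; exact: cg.
  move: kr ki; case: (I1 n) => a b; case: (I2 n) => c d /= h1 h2.
  by apply/eqP; rewrite eq_complex /=; apply/andP; split; apply/eqP; lra.
exists (T I1); split.
- rewrite (_ : (fun t => _) = (fun t => T ((derive1 phi t)%:C *: f t))).
    exact: bochner_image.
  by apply/funext => t; rewrite (linear_funZ Tlin).
- rewrite (_ : (fun t => _) = (fun t => T ((phi t)%:C *: g t))).
    rewrite (_ : - T I1 = T I2); first exact: bochner_image.
    by rewrite I12 -[in RHS](sub0r I1) (linear_funB Tlin) (linear_fun0 Tlin) sub0r.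
  by apply/funext => t; rewrite (linear_funZ Tlin).
Qed.

Lemma weak_derivative_functional (X : normedModType R[i]) (f g : R -> X)
    (l : X -> R) (phi : R -> R) : real_functional l ->
  weak_derivative tau f g -> test_function tau phi ->
  ae_integral D (fun t => derive1 phi t * l (f t) + phi t * l (g t)) 0.
Proof.
move=> lr wd tphi; have [I [b1 b2]] := wd _ tphi.
have h1 := bochner_functional (measurable_itv0 tau) (itv0_fin tau_gt0) lr b1.
have h2 := bochner_functional (measurable_itv0 tau) (itv0_fin tau_gt0) lr b2.
have := ae_integral_comb (measurable_itv0 tau) 1 1 h1 h2.
rewrite -(sub0r I) (real_functionalB _ _ lr) (real_functional0 lr) sub0r !mul1r subrr.
by apply: ae_integral_eq => t _; have [_ lZ _] := lr; rewrite !mul1r !lZ.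
Qed.

(** The Lipschitz condition with [phi 0 = 0] gives [|phi (f t)| <= |f t|]; it covers the norm itself
    and the coordinates alike. *)
Lemma L2_ae_integral (X : normedModType R[i]) (f : R -> X) (phi : X -> R) :
  L2 tau f -> (forall x y, `|phi x - phi y| <= normR (x - y)) -> phi 0 = 0 ->
  exists I, ae_integral D (fun t => phi (f t)) I.
Proof.
move=> [[s [ss [N [mN N0 sN]]]] f2] phil phi0.
have sf t : D t -> ~ N t -> s n t @[n --> \oo] --> f t.
  by move=> Dt Nt; apply: contrapT => h; apply: Nt; apply: sN => /= /(_ Dt).
have mNC : measurable (~` N : set (measurableTypeR R)) by exact: measurableC.
have meas (th : X -> R) : (forall x y, `|th x - th y| <= normR (x - y)) ->
    measurable_fun (T := measurableTypeR R) D (fun t => \1_(~` N) t * th (f t)).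
  move=> thl; apply: (@measurable_fun_cvg _ (measurableTypeR R) R D
     (fun n t => \1_(~` N) t * th (s n t))).
    move=> n; apply: measurable_funM; first by apply: measurable_indic; exact: mNC.
    exact: simple_comp_measurable.
  move=> t Dt; rewrite indicE; case: (boolP (t \in ~` N)) => [/set_mem Nt|_].
    apply: cvgMl_tmp; have /cvg_normR0 h := sf _ Dt Nt.
    apply/cvgrPdist_le => e e0; move/cvgrPdist_le : h => /(_ e e0).
    apply: filterS => m; rewrite sub0r normrN ger0_norm ?normR_ge0//.
    by apply: le_trans; rewrite normRBC.
  by rewrite mul0r; under eq_fun do rewrite mul0r; exact: cvg_cst.
pose F t : R := \1_(~` N) t * phi (f t).
pose G t : R := \1_(~` N) t * normR (f t).
have mF : measurable_fun (T := measurableTypeR R) D F by exact: meas.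
have mG : measurable_fun (T := measurableTypeR R) D G.
  by apply: meas => x y; exact: ler_dist_normR.
(* [1 + G^2] dominates [G] and is integrable because the interval has finite measure. *)
have iG : mu.-integrable D (fun t => (1 + G t ^+ 2)%:E).
  apply: (integrableD (measurable_itv0 tau) (f := cst 1%:E) (g := fun t => (G t ^+ 2)%:E)).
    apply/integrableP; split; first exact: measurable_cst.
    rewrite /= integral_cst; last exact: measurable_itv0.
    by rewrite lte_mul_pinfty ?lee_fin ?normr_ge0// itv0_fin.
  apply/integrableP; split; first by apply/measurable_EFinP; exact: measurable_funX.
  apply: le_lt_trans f2; apply: ge0_le_integral_nonmeasurable => t Dt; first exact: abse_ge0.
  rewrite /= lee_fin ger0_norm ?sqr_ge0// /G indicE.
  by case: (_ \in _); rewrite ?mul1r// mul0r expr0n/= sqr_ge0.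
exists (\int[mu]_(t in D) F t), F; split => //.
- apply: (le_integrable (measurable_itv0 tau) _ _ iG); first exact/measurable_EFinP.
  move=> t Dt; rewrite /= lee_fin [leRHS]ger0_norm; last by rewrite addr_ge0// sqr_ge0.
  apply: (@le_trans _ _ (G t)).
    rewrite /F /G indicE; case: (_ \in _); rewrite ?mul0r ?normr0// !mul1r.
    by have := phil (f t) 0; rewrite phi0 !subr0.
  have := sqr_ge0 (G t - 1); have := sqr_ge0 (G t); nra.
- exists N; split => // t /= h; apply: contrapT => Nt; apply: h => Dt.
  by rewrite /F indicE mem_set// mul1r.
Qed.

End WeakDerivative.

(** This decay, applied at each fixed time, is the pointwise convergence required by the final limit
    in [n]. *)
Lemma l2_coord_cvg0 (R : realType) (f : l2 R) :
  (fun n => complex.Re (f n)) @ \oo --> (0 : R) /\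
  (fun n => complex.Im (f n)) @ \oo --> (0 : R).
Proof.
have h : (fun n => sqn (f n)) @ \oo --> (0 : R).
  exact: cvg_series_cvg_0 (sqsum_cvg (l2_sqsum f)).
have key (phi : R[i] -> R) : (forall z, phi z ^+ 2 <= sqn z) ->
    (fun n => phi (f n)) @ \oo --> (0 : R).
  move=> hphi; apply/cvgrPdist_lt => e e0.
  have e2 : 0 < e ^+ 2 by rewrite exprn_gt0.
  move/cvgrPdist_lt : h => /(_ _ e2); apply: filterS => n.
  rewrite !sub0r !normrN ger0_norm ?sqn_ge0// => hn.
  rewrite -(@ltr_pXn2r _ 2) ?nnegrE ?(ltW e0)// real_normK ?num_real//.
  exact: le_lt_trans (hphi _) hn.
split; apply: key => z; rewrite /sqn; [rewrite lerDl|rewrite lerDr]; exact: sqr_ge0.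
Qed.

(** * The example *)

Section MoreSmooth.
Variable R : realType.
Implicit Types f : R -> R.

Lemma smooth_cos (w : R) : smooth (fun t => cos (w * t)).
Proof.
have := @smooth_trig R 1 0 w; congr smooth.
by apply/funext => t; rewrite mul1r mul0r addr0.
Qed.

Lemma smooth_sin (w : R) : smooth (fun t => sin (w * t)).
Proof.
have := @smooth_trig R 0 1 w; congr smooth.
by apply/funext => t; rewrite mul1r mul0r add0r.
Qed.

Lemma smoothN f : smooth f -> smooth (fun t => - f t).
Proof.
move=> sf; have := smoothM (@smooth_cst R (-1)) sf; congr smooth.
by apply/funext => t; rewrite mulN1r.
Qed.

End MoreSmooth.

Ltac smooth_tac := lazymatch goal with
  | |- smooth (fun t => cos (_ * t)) => exact: smooth_cos
  | |- smooth (fun t => sin (_ * t)) => exact: smooth_sin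
  | |- smooth (fun t => @?f t + @?g t) => apply: (@smoothD _ f g); smooth_tac
  | |- smooth (fun t => @?f t * @?g t) => apply: (@smoothM _ f g); smooth_tac
  | |- smooth (fun t => - @?f t) => apply: (@smoothN _ f); smooth_tac
  | |- smooth (fun=> ?c) => exact: (@smooth_cst _ c)
  end.

Section Example.
Variables (R : realType) (tau : R).
Hypothesis tau_gt0 : 0 < tau.
Local Notation mu := (@lebesgue_measure R).
Local Notation D := (`]0, tau[%classic : set R).

Definition freq n : R := (wt R n ^+ 2)^-1.
Definition omega : R := pi / tau.

Lemma omega_ge0 : 0 <= omega.
Proof. by rewrite divr_ge0 ?pi_ge0 ?ltW. Qed.

Definition xs (t : R) : R := sin (omega * t).
Definition dxs (t : R) : R := omega * cos (omega * t).

(* Real and imaginary parts, without the weight [w_n], of the vectors of the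
   introduction; for [n > 0] these are [- (1 - i) e / 4], [x e / 4],
   [(w_n^2 x' - i x) e / 4] and [w_n x' e / 4] with [e = exp(- i K_n t)]. *)
Definition coefS (t : R) n : R[i] := if n is 0 then 0 else
  (4^-1 * (sin (freq n * t) - cos (freq n * t))) +i*
  (4^-1 * (sin (freq n * t) + cos (freq n * t))).
Definition coefU (t : R) n : R[i] := if n is 0 then (xs t) +i* 0 else
  (4^-1 * (xs t * cos (freq n * t))) +i* (4^-1 * - (xs t * sin (freq n * t))).
Definition coefD (t : R) n : R[i] := if n is 0 then (dxs t) +i* 0 else
  (4^-1 * (wt R n ^+ 2 * (dxs t * cos (freq n * t)) - xs t * sin (freq n * t))) +i*
  (4^-1 * - (wt R n ^+ 2 * (dxs t * sin (freq n * t)) + xs t * cos (freq n * t))).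
Definition coefG (t : R) n : R[i] := if n is 0 then (dxs t + xs t) +i* 0 else
  (4^-1 * (wt R n * (dxs t * cos (freq n * t)))) +i*
  (4^-1 * - (wt R n * (dxs t * sin (freq n * t)))).

Lemma sqn_le_bound (z : R[i]) (M : R) :
  `|complex.Re z| <= M -> `|complex.Im z| <= M -> sqn z <= 2 * M ^+ 2.
Proof.
move=> h1 h2; have M0 : 0 <= M by apply: le_trans h1.
rewrite /sqn -(real_normK (x := complex.Re z)) ?num_real//.
rewrite -(real_normK (x := complex.Im z)) ?num_real//.
have : `|complex.Re z| ^+ 2 <= M ^+ 2 by rewrite ler_pXn2r ?nnegrE.
have : `|complex.Im z| ^+ 2 <= M ^+ 2 by rewrite ler_pXn2r ?nnegrE.
lra.
Qed.

Lemma ler_normM1 (a b A : R) : `|a| <= A -> `|b| <= 1 -> `|a * b| <= A.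
Proof.
by move=> aA b1; rewrite normrM -[leRHS]mulr1 ler_pM.
Qed.

Lemma norm_sin (y : R) : `|sin y| <= 1.
Proof. by rewrite ler_norml sin_geN1 sin_le1. Qed.

Lemma norm_cos (y : R) : `|cos y| <= 1.
Proof. by rewrite ler_norml cos_geN1 cos_le1. Qed.

Lemma norm_dxs t : `|dxs t| <= omega.
Proof.
by apply: ler_normM1; [rewrite ger0_norm ?omega_ge0|exact: norm_cos].
Qed.

Lemma norm4 (y A : R) : `|y| <= A -> `|4^-1 * y| <= A.
Proof.
move=> yA; rewrite normrM ger0_norm ?invr_ge0//; have := normr_ge0 y; lra.
Qed.

Lemma norm_wt (n : nat) (y A : R) : `|y| <= A -> `|wt R n * y| <= A.
Proof.
by move=> yA; rewrite mulrC; apply: ler_normM1; rewrite ?(ger0_norm (wt_ge0 _ _)) ?wt_le1.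
Qed.

Lemma norm_wt2 (n : nat) (y A : R) : `|y| <= A -> `|wt R n ^+ 2 * y| <= A.
Proof. by move=> yA; rewrite expr2 -mulrA; do 2!apply: norm_wt. Qed.

Lemma coefS_bound t n : sqn (coefS t n) <= 8^-1.
Proof.
case: n => [|n]; first by rewrite /sqn /= expr0n addr0 invr_ge0.
rewrite /sqn /= !exprMn; set a := freq _ * t; have := cos2Dsin2 a.
move: (cos a) (sin a) => c s h.
rewrite (_ : _ + _ = 8^-1 * (c ^+ 2 + s ^+ 2)); last by field.
by rewrite h mulr1.
Qed.

Let M : R := 1 + omega.

Let o0 := omega_ge0.

Lemma coefU_bound t n : sqn (coefU t n) <= 2 * M ^+ 2.
Proof.
have h a b : `|a| <= 1 -> `|b| <= 1 -> `|a * b| <= M :> R.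
  by move=> a1 b1; apply: (le_trans (ler_normM1 a1 b1)); rewrite lerDl.
apply: sqn_le_bound; case: n => [|n] /=.
- by rewrite (le_trans (norm_sin _))// lerDl.
- by apply: norm4; apply: h; [exact: norm_sin|exact: norm_cos].
- by rewrite normr0 addr_ge0.
- by apply: norm4; rewrite normrN; apply: h; exact: norm_sin.
Qed.

Lemma coefD_bound t n : sqn (coefD t n) <= 2 * M ^+ 2.
Proof.
have dx := norm_dxs t; apply: sqn_le_bound; case: n => [|n] /=.
- by rewrite (le_trans dx)// lerDr.
- apply: norm4; rewrite (le_trans (ler_normD _ _))// normrN addrC lerD//.
    by apply: ler_normM1; exact: norm_sin.
  by apply: norm_wt2; apply: ler_normM1; [|exact: norm_cos].
- by rewrite normr0 addr_ge0.
- apply: norm4; rewrite normrN (le_trans (ler_normD _ _))// addrC lerD//.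
    by apply: ler_normM1; [exact: norm_sin|exact: norm_cos].
  by apply: norm_wt2; apply: ler_normM1; [|exact: norm_sin].
Qed.

Lemma coefG_bound t n : sqn (coefG t n) <= 2 * M ^+ 2.
Proof.
have dx := norm_dxs t.
have dxM y : `|y| <= omega -> `|y| <= M by move=> h; rewrite (le_trans h)// lerDr.
apply: sqn_le_bound; case: n => [|n] /=.
- by rewrite (le_trans (ler_normD _ _))// addrC lerD// norm_sin.
- by apply: norm4; apply: norm_wt; apply: dxM; apply: ler_normM1; [|exact: norm_cos].
- by rewrite normr0 addr_ge0.
- by apply: norm4; rewrite normrN; apply: norm_wt; apply: dxM; apply: ler_normM1;
    [|exact: norm_sin].
Qed.

Definition Svec t := wvec (coefS t).
Definition uvec t := wvec (coefU t).
Definition Dvec t := wvec (coefD t).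
Definition gvec t := wvec (coefG t).

Lemma SvecE t n : Svec t n = (wt R n)%:C * coefS t n.
Proof. exact: wvecE (coefS_bound t) n. Qed.
Lemma uvecE t n : uvec t n = (wt R n)%:C * coefU t n.
Proof. exact: wvecE (coefU_bound t) n. Qed.
Lemma DvecE t n : Dvec t n = (wt R n)%:C * coefD t n.
Proof. exact: wvecE (coefD_bound t) n. Qed.
Lemma gvecE t n : gvec t n = (wt R n)%:C * coefG t n.
Proof. exact: wvecE (coefG_bound t) n. Qed.

Lemma Svec_continuous : continuous Svec.
Proof.
apply: (wvec_continuous (b := coefS) coefS_bound) => -[|n].
all: by apply: smooth_continuous; rewrite /= /xs /dxs; smooth_tac.
Qed.

Lemma uvec_continuous : continuous uvec.
Proof.
apply: (wvec_continuous (b := coefU) coefU_bound) => -[|n].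
all: by apply: smooth_continuous; rewrite /= /xs /dxs; smooth_tac.
Qed.

Lemma Dvec_continuous : continuous Dvec.
Proof.
apply: (wvec_continuous (b := coefD) coefD_bound) => -[|n].
all: by apply: smooth_continuous; rewrite /= /xs /dxs; smooth_tac.
Qed.

Lemma gvec_continuous : continuous gvec.
Proof.
apply: (wvec_continuous (b := coefG) coefG_bound) => -[|n].
all: by apply: smooth_continuous; rewrite /= /xs /dxs; smooth_tac.
Qed.

(** Since [|(1 - i) / 4|^2 = 1/8] and the weights contribute at most a factor 2, the squared norm is
    at most 1/4. The perturbation thus costs at most half of the coercivity of the inner product. *)
Lemma normR_Svec t : normR (Svec t) <= 2^-1.
Proof.
rewrite -(@ler_pXn2r _ 2) ?nnegrE ?normR_ge0 ?invr_ge0//.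
apply: (le_trans (normR_wvec (coefS_bound t))); lra.
Qed.

Lemma wt_neq0 n : wt R n != 0.
Proof. by rewrite gt_eqF ?wt_gt0. Qed.

Lemma wt0 : wt R 0 = 1. Proof. exact: expr0. Qed.

(** [coefD] is the derivative divided by [K_n], which stays bounded in [n]; the missing factor is
    compensated by the weights of [V']. *)
Lemma is_derive_coefU_Re n (t : R) : is_derive t 1 (fun s => complex.Re (coefU s n))
  (freq n * complex.Re (coefD t n)).
Proof.
case: n => [|n] /=.
  apply: is_derive_eq; rewrite /freq wt0 expr1n invr1 mul1r /GRing.scale /= /dxs; ring.
apply: is_derive_eq; rewrite /GRing.scale /= /dxs /freq /xs.
by field; exact: wt_neq0.
Qed.

Lemma is_derive_coefU_Im n (t : R) : is_derive t 1 (fun s => complex.Im (coefU s n))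
  (freq n * complex.Im (coefD t n)).
Proof.
case: n => [|n] /=.
  by rewrite mulr0; exact: is_derive_cst.
apply: is_derive_eq; rewrite /GRing.scale /= /dxs /freq /xs.
by field; exact: wt_neq0.
Qed.

End Example.

(** * The Riesz embedding of [l2] in its antidual *)

Section Riesz.
Variable R : realType.

Lemma inner_l2E (x y : l2 R) : inner x y = l2inner x y.
Proof. by []. Qed.

Fact riesz_subproof (y : l2 R) :
  (fun d => l2inner y d : R[i]^o) \in @bounded_antilinear R (l2 R).
Proof.
apply/asboolP; split=> [l v w|]; first exact: l2innerPr.
by exists (normR y) => d; exact: normR_inner y d.
Qed.

Definition riesz (y : l2 R) : antidual (l2 R) := Antidual (riesz_subproof y).

Lemma riesz_linear : linear riesz.
Proof. by move=> l x y; apply/val_inj/funext => d; exact: l2innerPl. Qed.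

Lemma riesz_inj : injective riesz.
Proof.
move=> x y xy; apply: l2_ext => n.
have : riesz x (basis R n) = riesz y (basis R n) by rewrite xy.
by rewrite /= !inner_basis.
Qed.

Lemma normR_riesz y : normR (riesz y) <= 1 * normR y.
Proof.
rewrite mul1r; apply: dual_norm_le; last exact: normR_ge0.
by move=> d; exact: normR_inner y d.
Qed.

Lemma embed_dual_diag (x : l2 R) : embed_dual (diag_embedding R) x = riesz (diag x).
Proof. by apply/val_inj/funext => d; rewrite /= inner_diag. Qed.

(** The derivative of an arbitrary solution is a function with values in [V']; evaluation at basis
    vectors reads its coordinates without a Riesz representative. *)
Lemma real_functional_dual_Re n :
  real_functional (fun F : antidual (l2 R) => complex.Re (F (basis R n))).
Proof.
split.
- move=> F G; rewrite -[(F + G) _]/(F (basis R n) + G (basis R n)).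
  by case: (F _) => ? ?; case: (G _).
- move=> r F; rewrite -[(r%:C *: F) _]/(r%:C * F (basis R n)).
  by case: (F _) => ? ? /=; rewrite mul0r subr0.
- exists (normR (basis R n)); first exact: normR_ge0.
  move=> F; rewrite mulrC; apply: le_trans (ler_dual_norm F (basis R n)).
  rewrite /normR; case: (F _) => p q; rewrite normc_def /=.
  by rewrite -[leLHS]sqrtr_sqr ler_wsqrtr// lerDl sqr_ge0.
Qed.

Lemma real_functional_dual_Im n :
  real_functional (fun F : antidual (l2 R) => complex.Im (F (basis R n))).
Proof.
split.
- move=> F G; rewrite -[(F + G) _]/(F (basis R n) + G (basis R n)).
  by case: (F _) => ? ?; case: (G _).
- move=> r F; rewrite -[(r%:C *: F) _]/(r%:C * F (basis R n)).
  by case: (F _) => ? ? /=; rewrite mul0r addr0.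
- exists (normR (basis R n)); first exact: normR_ge0.
  move=> F; rewrite mulrC; apply: le_trans (ler_dual_norm F (basis R n)).
  rewrite /normR; case: (F _) => p q; rewrite normc_def /=.
  by rewrite -[leLHS]sqrtr_sqr ler_wsqrtr// lerDr sqr_ge0.
Qed.

End Riesz.

(** * The rank-one form *)

Section Form.
Variables (R : realType) (tau : R).
Hypothesis tau_gt0 : 0 < tau.
Local Notation mu := (@lebesgue_measure R).
Local Notation D := (`]0, tau[%classic : set R).

Definition rank_one_form (t : R) (v w : l2 R) : R[i] :=
  l2inner v w + v 0%N * l2inner (Svec t) w.

Lemma rank_one_sesquilinear t : sesquilinear (rank_one_form t).
Proof.
split=> [l v1 v2 w|v l w1 w2]; rewrite /rank_one_form.
  by rewrite l2innerPl l2D l2Z !mulrDl mulrDr !addrA mulrA; congr (_ + _); rewrite addrAC.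
rewrite !l2innerPr /= !mulrDr !addrA; congr (_ + _).
by rewrite addrAC mulrCA.
Qed.

Lemma normR_coord (v : l2 R) n : normR (v n : R[i]^o) <= normR v.
Proof.
rewrite normR_l2 /normR; have := sqn_le_l2sqn v n; rewrite /sqn.
by case: (v n) => p q h; rewrite normc_def /=; exact: ler_wsqrtr.
Qed.

Lemma normR_mulC (a b : R[i]) : normR (a * b : R[i]^o) = normR (a : R[i]^o) * normR (b : R[i]^o).
Proof. exact: (normRZ (a : R[i]) (b : R[i]^o)). Qed.

Lemma Re_le_normRC (a : R[i]) : `|complex.Re a| <= normR (a : R[i]^o).
Proof.
case: a => p q; rewrite /normR normc_def /=.
by rewrite -[leLHS]sqrtr_sqr ler_wsqrtr// lerDl sqr_ge0.
Qed.

Lemma normR_rank_one (t : R) (v w : l2 R) : normR (v 0%N * l2inner (Svec t) w : R[i]^o) <=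
  2^-1 * normR v * normR w.
Proof.
rewrite normR_mulC (mulrC 2^-1) -mulrA.
apply: ler_pM; [exact: normR_ge0|exact: normR_ge0|exact: normR_coord|].
apply: (le_trans (normR_inner (Svec t) w)).
by apply: ler_wpM2r; [exact: normR_ge0|exact: normR_Svec].
Qed.

Lemma l2inner_measurable (f : R -> l2 R) (w : l2 R) (A : set R) : continuous f ->
  measurable_fun A (fun t => complex.Re (l2inner (f t) w)) /\
  measurable_fun A (fun t => complex.Im (l2inner (f t) w)).
Proof.
move=> cf; have h z : continuous (fun t => complex.Re (l2inner (f t) z)).
  by move=> t; apply: real_functional_cvg (real_functional_inner z) _; exact: cf.
split; apply: measurable_funTS; apply: continuous_measurable_fun; first exact: h.
(* By antilinearity in the second argument, [Im (f | w) = Re (f | i w)]. *)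
rewrite (_ : (fun t => _) = (fun t => complex.Re (l2inner (f t) ('i%C *: w)))); first exact: h.
apply/funext => t; rewrite l2innerZr; case: (l2inner (f t) w) => p q /=.
by rewrite mul0r mulN1r opprK add0r.
Qed.

Lemma rank_one_measurable v w :
  measurable_fun `[0, tau] (fun t => complex.Re (rank_one_form t v w)) /\
  measurable_fun `[0, tau] (fun t => complex.Im (rank_one_form t v w)).
Proof.
have cS : continuous (@Svec R) by exact: Svec_continuous.
have [hr hi] := l2inner_measurable w `[0, tau] cS.
split.
- rewrite (_ : (fun t => _) = (fun t => complex.Re (l2inner v w) +
    (complex.Re (v 0%N) * complex.Re (l2inner (Svec t) w) -
     complex.Im (v 0%N) * complex.Im (l2inner (Svec t) w)))).
    by apply: measurable_funD => //; apply: measurable_funB; apply: measurable_funM.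
  apply/funext => t; rewrite /rank_one_form.
  by case: (l2inner v w) => ? ?; case: (v 0%N) => ? ?; case: (l2inner _ w).
- rewrite (_ : (fun t => _) = (fun t => complex.Im (l2inner v w) +
    (complex.Re (v 0%N) * complex.Im (l2inner (Svec t) w) +
     complex.Im (v 0%N) * complex.Re (l2inner (Svec t) w)))).
    by apply: measurable_funD => //; apply: measurable_funD; apply: measurable_funM.
  apply/funext => t; rewrite /rank_one_form.
  by case: (l2inner v w) => ? ?; case: (v 0%N) => ? ?; case: (l2inner _ w).
Qed.

Lemma rank_one_bounded : exists M : R, 0 <= M /\ forall t v w, t \in `[0, tau] ->
  normR (rank_one_form t v w : R[i]^o) <= M * normR v * normR w.
Proof.
exists (3 / 2); split; first by rewrite divr_ge0.
move=> t v w _; apply: (le_trans (ler_normRD (l2inner v w : R[i]^o) _)).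
have := normR_inner v w; have := normR_rank_one t v w; rewrite inner_l2E.
set a := normR _; set b := normR (l2inner _ _ : R[i]^o) => h1 h2.
rewrite -mulrA in h1; rewrite -mulrA; lra.
Qed.

Lemma rank_one_coercive : exists alpha : R, 0 < alpha /\ forall t v, t \in `[0, tau] ->
  alpha * normR v ^+ 2 <= complex.Re (rank_one_form t v v).
Proof.
exists (2^-1); split; first by rewrite invr_gt0.
move=> t v _; rewrite /rank_one_form l2inner_diag.
have := normR_rank_one t v v; have := Re_le_normRC (v 0%N * l2inner (Svec t) v).
move: (normR _) => b h1 h2; have : `|complex.Re (v 0%N * l2inner (Svec t) v)| <=
   2^-1 * normR v ^+ 2 by rewrite expr2 mulrA; exact: le_trans h1 h2.
rewrite ler_norml normR_l2_sqr => /andP[h3 _].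
by move: h3; case: (v 0%N * l2inner (Svec t) v) => p q /=; lra.
Qed.

Definition example_form : coercive_form (l2 R) tau :=
  CoerciveForm (fun t _ => rank_one_sesquilinear t) rank_one_measurable
    rank_one_bounded rank_one_coercive.

End Form.

(** * The explicit solution *)

Section Solution.
Variables (R : realType) (tau : R).
Hypothesis tau_gt0 : 0 < tau.
Local Notation mu := (@lebesgue_measure R).
Local Notation D := (`]0, tau[%classic : set R).
Local Notation a := (example_form tau).
Local Notation j := (diag_embedding R).

Lemma equation_vec t : Dvec tau t + (uvec tau t + uvec tau t 0%N *: Svec t) =
  diag (gvec tau t).
Proof.
apply: l2_ext => n; rewrite diagE !l2D l2Z DvecE// uvecE// SvecE gvecE// uvecE//.
rewrite wt0 mul1r; case: n => [|n].
  by rewrite wt0 /= !mul1r mulr0 addr0; apply/eqP; rewrite eq_complex /= addr0 !eqxx.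
by rewrite /= /xs /dxs; apply/eqP; rewrite eq_complex /=; apply/andP; split; apply/eqP; field.
Qed.

Lemma evolution_example : weak_derivative tau
  (fun t => embed_dual j (j (uvec tau t))) (fun t => riesz (Dvec tau t)).
Proof.
rewrite (_ : (fun t => _) = (fun t => riesz (diag (diag (uvec tau t))))); last first.
  by apply/funext => t; rewrite embed_dual_diag.
apply: (weak_derivative_image tau_gt0 (f := fun t => diag (diag (uvec tau t)))).
- exact: riesz_linear.
- exact: riesz_inj.
- by exists 1; exact: normR_riesz.
- move=> t; apply: (@continuous_comp _ _ _ (fun t => diag (uvec tau t)) (@diag R)).
    apply: (@continuous_comp _ _ _ (uvec tau) (@diag R)); first exact: uvec_continuous.
    exact: diag_continuous.
  exact: diag_continuous.
- exact: Dvec_continuous.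
- move=> n t.
  (* One weight comes from [uvec] and two from [diag]; [w_n^3 K_n = w_n] is then the weight of
     [Dvec]. *)
  have H := is_deriveZ (wt R n ^+ 3) (is_derive_coefU_Re tau n t).
  rewrite (_ : (fun s => _) = wt R n ^+ 3 *: (fun s => complex.Re (coefU tau s n))); last first.
    apply/funext => s; rewrite -[RHS]/(wt R n ^+ 3 * complex.Re (coefU tau s n)) !diagE uvecE//.
    by case: (coefU tau s n) => p q /=; ring.
  apply: (is_derive_eq H); rewrite DvecE// /GRing.scale /= /freq.
  case: (coefD tau t n) => p q /=; field; exact: wt_neq0.
- move=> n t.
  have H := is_deriveZ (wt R n ^+ 3) (is_derive_coefU_Im tau n t).
  rewrite (_ : (fun s => _) = wt R n ^+ 3 *: (fun s => complex.Im (coefU tau s n))); last first.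
    apply/funext => s; rewrite -[RHS]/(wt R n ^+ 3 * complex.Im (coefU tau s n)) !diagE uvecE//.
    by case: (coefU tau s n) => p q /=; ring.
  apply: (is_derive_eq H); rewrite DvecE// /GRing.scale /= /freq.
  case: (coefD tau t n) => p q /=; field; exact: wt_neq0.
Qed.

Lemma riesz_comp_continuous (f : R -> l2 R) : continuous f ->
  continuous (fun t => riesz (f t)).
Proof.
move=> cf t; apply: (bounded_cvg (@riesz_linear R)); last exact: cf.
by exists 1; exact: normR_riesz.
Qed.

Lemma example_solution (Phi : l2 R -> l2 R) : Phi 0 = 0 ->
  solution j a Phi (gvec tau) (uvec tau).
Proof.
move=> Phi0; have cu := @uvec_continuous R tau tau_gt0.
have cd : continuous (fun t => diag (uvec tau t)).
  by move=> t; apply: (@continuous_comp _ _ _ (uvec tau) (@diag R));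
    [exact: cu|exact: diag_continuous].
have cdd : continuous (fun t => diag (diag (uvec tau t))).
  by move=> t; apply: (@continuous_comp _ _ _ (fun t => diag (uvec tau t)) (@diag R));
    [exact: cd|exact: diag_continuous].
have LD : L2 tau (fun t => riesz (Dvec tau t)).
  by apply: continuous_L2 => //; apply: riesz_comp_continuous; exact: Dvec_continuous.
split.
- split; first exact: continuous_L2.
  split; last by exists (fun t => riesz (Dvec tau t)); split => //; exact: evolution_example.
  rewrite (_ : (fun t => _) = (fun t => riesz (diag (diag (uvec tau t))))).
    by apply: continuous_L2 => //; exact: riesz_comp_continuous.
  by apply/funext => t; rewrite embed_dual_diag.
- exists (fun t => riesz (Dvec tau t)); split => //; first exact: evolution_example.
  apply: aeW => t tI.
  have tI' : t \in `[0, tau] by move: tI; rewrite !in_itv /= => /andP[/ltW -> /ltW ->].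
  rewrite embed_dual_diag -equation_vec//; apply/val_inj/funext => d.
  rewrite -[LHS]/(l2inner (Dvec tau t) d + form_op a t (uvec tau t) d) form_opE//.
  rewrite -[RHS]/(l2inner (Dvec tau t + (uvec tau t + uvec tau t 0%N *: Svec t)) d).
  have l2innerDl x y : l2inner (x + y) d = l2inner x d + l2inner y d.
    by have := l2innerPl d 1 x y; rewrite scale1r mul1r.
  by rewrite !l2innerDl l2innerZl.
- exists (fun t => diag (uvec tau t)); split.
  + exact: continuous_subspaceT.
  + exact: aeW.
  + have z t : xs tau t = 0 -> diag (uvec tau t) = 0.
      move=> x0; apply: l2_ext => n; rewrite diagE uvecE//.
      case: n => [|n] /=; rewrite x0 ?mul0r ?oppr0 ?mulr0.
        by apply/eqP; rewrite eq_complex /=; apply/andP; split; apply/eqP; ring.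
      by apply/eqP; rewrite eq_complex /=; apply/andP; split; apply/eqP; ring.
    rewrite (z 0) ?(z tau) ?Phi0//.
      by rewrite /xs /omega divfK ?sinpi// gt_eqF.
    by rewrite /xs mulr0 sin0.
Qed.

End Solution.

(** * Failure of maximal regularity *)

Section Nonregularity.
Variables (R : realType) (tau : R).
Hypothesis tau_gt0 : 0 < tau.
Local Notation mu := (@lebesgue_measure R).
Local Notation D := (`]0, tau[%classic : set R).
Local Notation a := (example_form tau).
Local Notation j := (diag_embedding R).
Local Notation mD := (measurable_itv0 tau).

Section Solution.
Variables (y h : R -> l2 R) (du : R -> antidual (l2 R)).
Hypotheses (Ly : L2 tau y) (Lh : L2 tau h).
Hypothesis wdh : weak_derivative tau (fun t => j (y t)) h.
Hypothesis wdu : weak_derivative tau (fun t => embed_dual j (j (y t))) du.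
Hypothesis eqn : {ae mu, forall t, t \in `]0, tau[ ->
  du t + form_op a t (y t) = embed_dual j (gvec tau t)}.

Lemma weak_coord_Re phi n : test_function tau phi ->
  ae_integral D (fun t => derive1 phi t * (wt R n * complex.Re (y t n)) +
    phi t * complex.Re (h t n)) 0.
Proof.
move=> tphi.
have := weak_derivative_functional tau_gt0 (real_functional_Re R n) wdh tphi.
apply: ae_integral_eq => t _; congr (_ * _ + _).
by rewrite diagE; case: (y t n) => ? ? /=; rewrite mul0r subr0.
Qed.

Lemma weak_coord_Im phi n : test_function tau phi ->
  ae_integral D (fun t => derive1 phi t * (wt R n * complex.Im (y t n)) +
    phi t * complex.Im (h t n)) 0.
Proof.
move=> tphi.
have := weak_derivative_functional tau_gt0 (real_functional_Im R n) wdh tphi.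
apply: ae_integral_eq => t _; congr (_ * _ + _).
by rewrite diagE; case: (y t n) => ? ? /=; rewrite mul0r addr0.
Qed.

Lemma equation_coord : {ae mu, forall t, D t -> forall n,
  du t (basis R n) = (wt R n)%:C * (gvec tau t n - y t 0%N * coefS t n) - y t n}.
Proof.
apply: aeS eqn => t h1 tD n; have {h1} := h1 tD.
have tI : t \in `[0, tau] by move: tD; rewrite /= !in_itv /= => /andP[/ltW -> /ltW ->].
rewrite embed_dual_diag => /(congr1 (fun F : antidual (l2 R) => F (basis R n))).
rewrite -[LHS]/(du t (basis R n) + form_op a t (y t) (basis R n)) form_opE//.
rewrite -[RHS]/(l2inner (diag (gvec tau t)) (basis R n)).
rewrite -[a t _ _]/(l2inner (y t) (basis R n) + y t 0%N * l2inner (Svec t) (basis R n)).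
rewrite !inner_basis diagE SvecE => /(canRL (addrK _)) ->.
by rewrite mulrBr opprD addrA [in RHS]addrAC mulrCA.
Qed.

(** The same function has weak derivative [du] in [V'] and [h] in [H], with coordinates [w_n^2 y_n]
    and [w_n y_n]. Subtracting the second identity from [w_n^-1] times the first eliminates the
    derivative of [phi]. *)
Lemma equation_coord_Re phi n : test_function tau phi ->
  ae_integral D (fun t => phi t * (complex.Re (gvec tau t n) -
    (wt R n)^-1 * complex.Re (y t n) - complex.Re (y t 0%N * coefS t n) -
    complex.Re (h t n))) 0.
Proof.
move=> tphi; have hA := weak_coord_Re n tphi.
have hB := weak_derivative_functional tau_gt0 (real_functional_dual_Re R n) wdu tphi.
have := ae_integral_comb mD (wt R n)^-1 (-1) hB hA.
rewrite !mulr0 addr0; apply: ae_integral_ae_eq; apply: aeS equation_coord => t E tD.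
rewrite E// embed_dual_diag.
rewrite -[riesz _ _]/(l2inner (diag (diag (y t))) (basis R n)) inner_basis !diagE.
have := wt_neq0 R n; case: (y t n) => p q; case: (gvec tau t n) => r s.
by case: (y t 0%N * coefS t n) => u v w0 /=; field.
Qed.

Lemma equation_coord_Im phi n : test_function tau phi ->
  ae_integral D (fun t => phi t * (complex.Im (gvec tau t n) -
    (wt R n)^-1 * complex.Im (y t n) - complex.Im (y t 0%N * coefS t n) -
    complex.Im (h t n))) 0.
Proof.
move=> tphi; have hA := weak_coord_Im n tphi.
have hB := weak_derivative_functional tau_gt0 (real_functional_dual_Im R n) wdu tphi.
have := ae_integral_comb mD (wt R n)^-1 (-1) hB hA.
rewrite !mulr0 addr0; apply: ae_integral_ae_eq; apply: aeS equation_coord => t E tD.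
rewrite E// embed_dual_diag.
rewrite -[riesz _ _]/(l2inner (diag (diag (y t))) (basis R n)) inner_basis !diagE.
have := wt_neq0 R n; case: (y t n) => p q; case: (gvec tau t n) => r s.
by case: (y t 0%N * coefS t n) => u v w0 /=; field.
Qed.

(* What is left when the coordinate equations, tested with
   [psi (sin(K_n t) - cos(K_n t))] and [- psi (sin(K_n t) + cos(K_n t))], are
   combined so that the terms of order [w_n^-1 = w_n K_n] cancel. *)
Definition remainder (psi : R -> R) n t : R :=
  let c := cos (freq R n * t) in let s := sin (freq R n * t) in
  psi t * (s - c) * complex.Re (gvec tau t n)
  + psi t * (s + c) * complex.Im (gvec tau t n)
  - 2 * psi t * s * complex.Re (h t n)
  - 2 * psi t * c * complex.Im (h t n)
  + wt R n * derive1 psi t * ((s - c) * complex.Im (y t n) - (s + c) * complex.Re (y t n)).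

(** Here [p + i q = psi conj(4 coefS)], a multiple of [psi exp(i K_n t)]. Up to a term in [psi'],
    its derivative is [i K_n (p + i q)], so the imaginary part of the weak identity for [h] contains
    [w_n K_n Re ((p + i q) y_n)], which cancels the [w_n^-1] term in the real part of the other
    equation. The [y_0] term becomes [4 |coefS|^2 psi Re y_0], that is [psi Re y_0 / 2]. The index
    is [n.+1] because [coefS] vanishes at 0. *)
Lemma remainder_integral psi n : test_function tau psi ->
  ae_integral D (fun t => remainder psi n.+1 t - 2^-1 * (psi t * complex.Re (y t 0%N))) 0.
Proof.
move=> tpsi; set k := freq R n.+1.
pose p t := psi t * (sin (k * t) - cos (k * t)).
pose q t := psi t * - (sin (k * t) + cos (k * t)).
have tp : test_function tau p by apply: testM => //; smooth_tac.
have tq : test_function tau q by apply: testM => //; smooth_tac.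
have dpsi (t : R) := derivable_is_derive (fun t => smooth_derivable (test_smooth tpsi) (t := t)) t.
have dp t : derive1 p t = derive1 psi t * (sin (k * t) - cos (k * t))
    + psi t * (k * (cos (k * t) + sin (k * t))).
  rewrite derive1E /p; apply: derive_val.
  have dp' := dpsi t; apply: is_derive_eq; rewrite /GRing.scale /=; ring.
have dq t : derive1 q t = - (derive1 psi t * (sin (k * t) + cos (k * t)))
    - psi t * (k * (cos (k * t) - sin (k * t))).
  rewrite derive1E /q; apply: derive_val.
  have dp' := dpsi t; apply: is_derive_eq; rewrite /GRing.scale /=; ring.
have h1 := ae_integral_comb mD 1 1 (weak_coord_Re n.+1 tq) (weak_coord_Im n.+1 tp).
have h2 := ae_integral_comb mD 1 (-1) (equation_coord_Re n.+1 tp) (equation_coord_Im n.+1 tq).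
have := ae_integral_comb mD 1 1 h1 h2.
rewrite !(mulr0, addr0); apply: ae_integral_eq => t _.
rewrite dp dq /remainder /p /q -/k.
have w0 := wt_neq0 R n.+1; have cs := cos2Dsin2 (k * t).
(* Inserting [cos^2 + sin^2 = 1] turns the claim into a rational identity that holds with [c] and
   [s] independent. *)
have -> : 2^-1 * (psi t * complex.Re (y t 0%N)) =
  2^-1 * (psi t * complex.Re (y t 0%N)) * (cos (k * t) ^+ 2 + sin (k * t) ^+ 2).
  by rewrite cs mulr1.
rewrite /coefS -/k; move: w0; rewrite /k /freq; move: (wt R n.+1) => w w0.
move: (cos _) (sin _) (psi t) (derive1 psi t) => c s P P'.
case: (y t n.+1) => y1 y2; case: (h t n.+1) => h1' h2'; case: (y t 0%N) => z1 z2.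
by case: (gvec tau t n.+1) => g1 g2 /=; field.
Qed.

Lemma remainder_bound psi : test_function tau psi -> exists C : R, 0 <= C /\
  forall n t, `|remainder psi n t| <= C *
   ((`|complex.Re (gvec tau t n)| + `|complex.Im (gvec tau t n)|) +
    (`|complex.Re (h t n)| + `|complex.Im (h t n)|) +
    (`|complex.Re (y t n)| + `|complex.Im (y t n)|)).
Proof.
move=> tpsi; have [A hA] := test_bounded tau_gt0 tpsi.
have [B hB] := test_bounded tau_gt0 (test_derive1 tpsi).
have A0 : 0 <= A by apply: le_trans (hA 0).
have B0 : 0 <= B by apply: le_trans (hB 0).
(* [A] and [B] bound [psi] and its derivative; 2 bounds [|s - c|] and [|s + c|]. *)
exists (2 * A + 2 * B); split; first by lra.
move=> n t; rewrite /remainder; set k := freq R n * t.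
have c1 := norm_cos k; have s1 := norm_sin k.
have w1 : `|wt R n| <= 1 by rewrite ger0_norm ?wt_ge0 ?wt_le1.
move: (cos k) (sin k) c1 s1 (hA t) (hB t) => c s c1 s1 PA PB.
move: (psi t) (derive1 psi t) PA PB => P P' PA PB.
have key (u v u' v' w' z' : R) : `|P * (s - c) * u + P * (s + c) * v - 2 * P * s * u'
    - 2 * P * c * v' + wt R n * P' * ((s - c) * w' - (s + c) * z')| <=
    2 * A * (`|u| + `|v|) + 2 * A * (`|u'| + `|v'|) + 2 * B * (`|z'| + `|w'|).
  have PM x d : `|d| <= 2 -> `|P * d * x| <= 2 * A * `|x|.
    move=> d2; rewrite !normrM ler_wpM2r// mulrC.
    by apply: ler_pM => //.
  have d1 : `|s - c| <= 2.
    by rewrite (le_trans (ler_normB _ _))// (_ : 2 = 1 + 1) ?lerD//; ring.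
  have d2 : `|s + c| <= 2.
    by rewrite (le_trans (ler_normD _ _))// (_ : 2 = 1 + 1) ?lerD//; ring.
  have e1 := PM u _ d1; have e2 := PM v _ d2.
  have e3 : `|2 * P * s * u'| <= 2 * A * `|u'|.
    rewrite (_ : 2 * P * s = P * (2 * s)); last by ring.
    by apply: PM; rewrite normrM ger0_norm// ler_piMr.
  have e4 : `|2 * P * c * v'| <= 2 * A * `|v'|.
    rewrite (_ : 2 * P * c = P * (2 * c)); last by ring.
    by apply: PM; rewrite normrM ger0_norm// ler_piMr.
  have wP : `|wt R n * P'| <= B.
    by rewrite normrM; apply: le_trans PB; rewrite ler_piMl.
  have e5 : `|wt R n * P' * ((s - c) * w' - (s + c) * z')| <= 2 * B * (`|z'| + `|w'|).
    rewrite normrM (mulrC 2) -mulrA; apply: ler_pM => //.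
    apply: (le_trans (ler_normB _ _)); rewrite !normrM addrC mulrDr.
    by apply: lerD; apply: ler_wpM2r.
  apply: (le_trans (ler_normD _ _)); apply: lerD e5.
  apply: (le_trans (ler_normB _ _)).
  have := le_trans (ler_normB _ _)
    (lerD (ler_normD (P * (s - c) * u) (P * (s + c) * v)) (lexx `|2 * P * s * u'|)).
  by lra.
apply: (le_trans (key _ _ _ _ _ _)).
set G := `|complex.Re (gvec tau t n)| + _; set H := `|complex.Re (h t n)| + _.
set Y := `|complex.Re (y t n)| + _.
have BG : 0 <= B * G by rewrite mulr_ge0// addr_ge0.
have BH : 0 <= B * H by rewrite mulr_ge0// addr_ge0.
have AY : 0 <= A * Y by rewrite mulr_ge0// addr_ge0.
lra.
Qed.

(** With [J] the integral in question, [remainder psi n.+1] has integral [J / 2] for every [n]. Its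
    integrand tends to 0 pointwise and is dominated by a multiple of [|g| + |h| + |y|], so this
    constant sequence tends to 0. *)
Lemma pairing_y0_eq0 psi : test_function tau psi ->
  ae_integral D (fun t => psi t * complex.Re (y t 0%N)) 0.
Proof.
move=> tpsi; have [C [C0 hC]] := remainder_bound tpsi.
have normI (f : R -> l2 R) : L2 tau f -> exists I, ae_integral D (fun t => normR (f t)) I.
  move=> Lf; apply: (L2_ae_integral tau_gt0 Lf); last exact: normR0.
  by move=> u v; exact: ler_dist_normR.
have [I1 i1] := normI _ (continuous_L2 tau_gt0 (gvec_continuous (tau := tau) tau_gt0)).
have [I2 i2] := normI _ Lh; have [I3 i3] := normI _ Ly.
have [J0 j0] : exists I, ae_integral D (fun t => complex.Re (y t 0%N)) I.
  apply: (L2_ae_integral tau_gt0 (phi := fun x : l2 R => complex.Re (x 0%N)) Ly) => //.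
  move=> u v; rewrite -(real_functionalB _ _ (real_functional_Re R 0)).
  exact: Re_le_normR.
have [A hA] := test_bounded tau_gt0 tpsi.
have mpsi : measurable_fun (T := measurableTypeR R) D psi.
  apply: measurable_funTS; apply: continuous_measurable_fun.
  exact: smooth_continuous (test_smooth tpsi).
have [J hJ] := ae_integral_mul_bounded mD mpsi hA j0.
have rem n : ae_integral D (remainder psi n.+1) (2^-1 * J).
  have := ae_integral_comb mD 1 2^-1 (remainder_integral n tpsi) hJ.
  by rewrite mulr0 add0r; apply: ae_integral_eq => t _; rewrite mul1r subrK.
have H12 := ae_integral_comb mD (2 * C) (2 * C) i1 i2.
have H := ae_integral_comb mD 1 (2 * C) H12 i3.
have cv : (fun n : nat => 2^-1 * J) @ \oo --> (0 : R).
  apply: (ae_integral_cvg0 mD rem H) => [n t tD|t tD].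
    apply: (le_trans (hC _ _)).
    have := Re_le_normR (gvec tau t) n.+1; have := Im_le_normR (gvec tau t) n.+1.
    have := Re_le_normR (h t) n.+1; have := Im_le_normR (h t) n.+1.
    have := Re_le_normR (y t) n.+1; have := Im_le_normR (y t) n.+1.
    move=> a1 a2 a3 a4 a5 a6.
    apply: (@le_trans _ _ (C * (2 * normR (gvec tau t) + 2 * normR (h t) + 2 * normR (y t)))).
      by apply: ler_wpM2l => //; lra.
    by rewrite mul1r; lra.
  have cvn (f : l2 R) : (fun n => `|complex.Re (f n.+1)| + `|complex.Im (f n.+1)|) @ \oo
      --> (0 : R).
    have [hr hi] := l2_coord_cvg0 f.
    have hr' : (fun n => complex.Re (f n.+1)) @ \oo --> (0 : R).
      by rewrite (cvg_shiftS (fun n => complex.Re (f n))).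
    have hi' : (fun n => complex.Im (f n.+1)) @ \oo --> (0 : R).
      by rewrite (cvg_shiftS (fun n => complex.Im (f n))).
    have H1 := cvgD (cvg_norm hr') (cvg_norm hi').
    by rewrite normr0 addr0 in H1; exact: H1.
  have cvB : (fun n => C * ((`|complex.Re (gvec tau t n.+1)| + `|complex.Im (gvec tau t n.+1)|)
     + (`|complex.Re (h t n.+1)| + `|complex.Im (h t n.+1)|)
     + (`|complex.Re (y t n.+1)| + `|complex.Im (y t n.+1)|))) @ \oo --> (0 : R).
    have H1 := cvgMl_tmp (a := C) (cvgD (cvgD (cvn (gvec tau t)) (cvn (h t))) (cvn (y t))).
    by rewrite !addr0 mulr0 in H1; exact: H1.
  apply/cvgrPdist_le => e e0; move/cvgrPdist_le : cvB => /(_ _ e0).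
  apply: filterS => n; rewrite !sub0r !normrN => hn.
  by apply: (le_trans (hC _ _)); apply: le_trans hn; exact: ler_norm.
have : 2^-1 * J = 0.
  exact: (cvg_unique (@Rhausdorff R) (cvg_cst _) cv).
by move=> /eqP; rewrite mulf_eq0 invr_eq0 pnatr_eq0 /= => /eqP J00; move: hJ; rewrite J00.
Qed.

Lemma no_regular_solution : False.
Proof.
(* On []tau / 8, tau / 4[] the angle [omega t] lies in []0, pi / 4[], where sine and cosine are
   positive, hence [x' + x > 0]. *)
have t0 := tau_gt0; have b1 : tau / 8 < tau / 4 by lra.
have [||phi [tphi phi0 phip phin]] :=
  bump_exists (a := tau / 8) (b := tau / 4) _ b1 (tau := tau); try lra.
have h1 := pairing_y0_eq0 tphi.
have h2 := pairing_y0_eq0 (test_derive1 tphi).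
have hA := weak_coord_Re 0 tphi.
have hC := equation_coord_Re 0 tphi.
(* This sum eliminates [h_0] and leaves the weak scalar equation for [y_0]. [S2] then removes both
   [y_0] terms, by the vanishing pairings with [phi] and its derivative, so only [phi (x' + x)]
   survives. *)
have S1 := ae_integral_comb mD 1 1 hA hC.
have S2 := ae_integral_comb mD 1 (-1) h1 h2.
have S3 := ae_integral_comb mD 1 1 S1 S2.
pose f t := phi t * (dxs tau t + xs tau t).
have F0 : ae_integral D f 0.
  move: S3; rewrite !(mulr0, addr0); apply: ae_integral_eq => t _.
  rewrite /f gvecE// wt0 /coefG /coefS invr1 /=; case: (y t 0%N) => y1 y2 /=; ring.
have fge t : tau / 8 < t < tau / 4 -> 0 < f t.
  move=> tI; have /andP[t1 t2] := tI; rewrite mulr_gt0 ?phip//.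
  have pi0 : 0 < pi :> R := pi_gt0 R.
  have o0 : 0 < omega tau by rewrite divr_gt0.
  have ot : omega tau * t < pi / 4.
    have -> : pi / 4 = omega tau * (tau / 4) by rewrite /omega; field; rewrite gt_eqF.
    by rewrite ltr_pM2l.
  have ot0 : 0 < omega tau * t by rewrite mulr_gt0//; lra.
  rewrite addr_gt0// /dxs /xs; last by apply: sin_gt0_pi; rewrite ot0 /=; lra.
  rewrite mulr_gt0//; apply: cos_gt0_pihalf; apply/andP; split; lra.
have cg : continuous (fun t => dxs tau t + xs tau t).
  by apply: smooth_continuous; rewrite /dxs /xs; smooth_tac.
have cf : continuous f.
  by move=> t; apply: cvgM; [exact: smooth_continuous (test_smooth tphi) t|exact: cg].
(* [[5 tau / 32, 6 tau / 32]] lies strictly inside the support of the bump, so [f] has a positive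
   minimum there, which bounds its integral from below. *)
have [|c cI cmin] := @EVT_min R f (tau * 5 / 32) (tau * 6 / 32) _
  (continuous_subspaceT cf); first by lra.
have fc : 0 < f c.
  by apply: fge; move: cI; rewrite in_itv /= => /andP[c1 c2]; apply/andP; split; lra.
pose B := `[tau * 5 / 32, tau * 6 / 32]%classic : set R.
have mB : measurable B by exact: measurable_itv.
have iB := ae_integral_indic mD (itv0_fin tau_gt0) mB.
have iB' := ae_integral_comb mD (f c) 0 iB iB.
have := ae_integral_le mD _ iB' F0.
have -> : D `&` B = B.
  apply/seteqP; split => t /=; first by case.
  move=> tB; split => //; move: tB; rewrite /B /= !in_itv /= => /andP[t1 t2].
  by apply/andP; split; lra.
rewrite mul0r addr0 /B lebesgue_measure_itv /= lte_fin ifT; last by lra.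
rewrite /= => H; have : f c * (tau * 6 / 32 - tau * 5 / 32) <= 0.
  apply: H; apply: aeW => t tD; rewrite mul0r addr0 indicE.
  case: (boolP (t \in _)) => [/set_mem tB|_]; first by rewrite mulr1; exact: cmin.
  rewrite mulr0; have [/fge/ltW//|nI] := pselect (tau / 8 < t < tau / 4).
  by rewrite /f phin// mul0r.
have : 0 < f c * (tau * 6 / 32 - tau * 5 / 32) by rewrite mulr_gt0//; lra.
lra.
Qed.

End Solution.
End Nonregularity.

Theorem theorem7p1 (R : realType) (tau : R) (tau_gt0 : 0 < tau) :
  exists V H : hilbertType R,
    separable_space V /\ separable_space H /\
    exists (j : dense_embedding V H) (a : coercive_form V tau),
      forall Phi : H -> H, bounded_operator Phi ->
        exists g : R -> H, L2 tau g /\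
          (exists u : R -> V, solution j a Phi g u) /\
          (forall u : R -> V, solution j a Phi g u -> ~ MR_VH tau j u).
Proof.
exists (l2 R), (l2 R); split; first exact: l2_separable.
split; first exact: l2_separable.
exists (diag_embedding R), (example_form tau) => Phi [Phi_lin _].
exists (gvec tau); split.
  by apply: continuous_L2 => //; exact: gvec_continuous.
split.
  by exists (uvec tau); apply: example_solution => //; exact: linear_fun0 Phi_lin.
move=> y [_ [du [_ wdu eqn]] _] [Ly [_ [h [Lh wdh]]]].
exact: no_regular_solution Ly Lh wdh wdu eqn.
Qed.
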